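(* Let $\theta$ be a real number and let $G$ be a finite weighted multi-graph without a $\theta$-Aomoto subset. Then there exists a $2$-regular subgraph $\Gamma$ of $G$ such that $\theta$ is not a zero of the matching polynomial $\mu^{G\setminus\Gamma}(x)$ of $G\setminus\Gamma$.
   Context: A finite weighted multi-graph $G=(V(G),E(G))$ may have loops and parallel edges. Every edge (including a loop) corresponds to two mutually inverse arcs $e,e^{-1}$, with origin $o(e)$ and terminus $t(e)$; $\vec E(G)$ is the set of arcs. Each vertex $i$ has a weight $r_i\in\mathbb{R}$, and each arc $e$ has a weight $\rho_e\in\mathbb{C}$ with $\rho_{e^{-1}}=\overline{\rho_e}\neq 0$. Subgraphs inherit weights. The adjacency matrix is $A^G_{ij}=r_i\delta_{ij}+\sum_{e\in\vec E(G),\,o(e)=i,\,t(e)=j}\rho_e$, and eigenvalues of $G$ are those of $A^G$. For $S\subseteq V(G)$: $G[S]$ is the subgraph induced by $S$, $G\setminus S=G[V(G)\setminus S]$, and the frontier $\partial_G S$ is the set of vertices outside $S$ that have a neighbor in $S$. For a subgraph $H$, $G\setminus H=G\setminus V(H)$; $\mathrm{cc}(H)$ is the number of connected components of $H$. A loop is a cycle of length $1$ and two distinct parallel edges form a cycle of length $2$. A forest is a multi-graph without cycles. A $2$-regular subgraph of $G$ is a disjoint union of cycles of $G$ (cycles of length $1$ and $2$ allowed); the empty subgraph (union of no cycles) is included. Matching polynomial: a matching is a set of edges forming a $1$-regular subgraph (so it contains no loops); $\mathcal{M}_G$ is the set of matchings; for an edge $e$ put $\lambda_e=-|\rho_{\vec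 e}|^2$ with $\vec e$ either arc of $e$. Then $\mu^G(x)=\sum_{M\in\mathcal{M}_G}\prod_{i\notin M}(x-r_i)\prod_{e\in M}\lambda_e$, where $i\notin M$ means that $i$ is not saturated by $M$ (the empty multi-graph has $\mu=1$). A subset $S\subseteq V(G)$ is a $\theta$-Aomoto subset of $G$ if: $G[S]$ is a forest; $\theta$ is an eigenvalue of each component of $G[S]$; and $|\partial_G S|<\mathrm{cc}(G[S])$. *)

(* Defs.v *)
From mathcomp Require Export all_boot all_order all_algebra.
From mathcomp Require Export reals.
From mathcomp Require Export complex.

Set Implicit Arguments.
Unset Strict Implicit.
Unset Printing Implicit Defensive.

Import Order.TTheory GRing.Theory Num.Theory.
Open Scope ring_scope.
Open Scope complex_scope.

(* A multi-graph is given by its arcs; an edge is a pair {e, e^-1} of mutually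
   inverse arcs, which are distinct even when the edge is a loop. *)
Record wmgraph (R : realType) := WMGraph {
  vertex : finType;
  arc : finType;
  org : arc -> vertex;
  ainv : arc -> arc;
  vweight : vertex -> R;
  aweight : arc -> R[i];
  ainvK : involutive ainv;
  ainv_neq : forall e, ainv e != e;
  aweightV : forall e, aweight (ainv e) = conjc (aweight e);
  aweight_neq0 : forall e, aweight e != 0
}.

(* The terminus is determined by t(e) = o(e^-1). *)
Definition tgt (R : realType) (G : wmgraph R) (e : arc G) : vertex G :=
  org (ainv e).

(* All graph notions are defined for subgraphs of an ambient multi-graph [G],
   whose weights they inherit; [G] itself is [fullg G]. *)
Record subgraph (R : realType) (G : wmgraph R) := SubGraph {
  verts : {set vertex G};
  arcs : {set arc G};
  arcs_inv : forall e, e \in arcs -> ainv e \in arcs;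
  arcs_org : forall e, e \in arcs -> org e \in verts
}.

Section Subgraphs.

Variables (R : realType) (G : wmgraph R).
Implicit Types (H : subgraph G) (S : {set vertex G}) (s : seq (arc G)).

Lemma fullg_arcs_inv (e : arc G) : e \in [set: arc G] -> ainv e \in [set: arc G].
Proof. by rewrite !inE. Qed.

Lemma fullg_arcs_org (e : arc G) :
  e \in [set: arc G] -> org e \in [set: vertex G].
Proof. by rewrite !inE. Qed.

Definition fullg : subgraph G := SubGraph fullg_arcs_inv fullg_arcs_org.

Definition induced_arcs H S : {set arc G} :=
  [set e in arcs H | (org e \in S) && (tgt e \in S)].

Lemma induced_arcs_inv H S (e : arc G) :
  e \in induced_arcs H S -> ainv e \in induced_arcs H S.
Proof.
rewrite !inE /tgt ainvK => /andP[eH /andP[oS tS]].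
by rewrite arcs_inv //= tS oS.
Qed.

Lemma induced_arcs_org H S (e : arc G) :
  e \in induced_arcs H S -> org e \in verts H :&: S.
Proof. by rewrite !inE => /andP[/arcs_org -> /andP[->]]. Qed.

Definition induced H S : subgraph G :=
  SubGraph (@induced_arcs_inv H S) (@induced_arcs_org H S).

Definition delete_set H S : subgraph G := induced H (~: S).

Definition delete_subgraph H (K : subgraph G) : subgraph G :=
  delete_set H (verts K).

Definition adj H : rel (vertex G) :=
  [rel i j | [exists e in arcs H, (org e == i) && (tgt e == j)]].

Definition frontier H S : {set vertex G} :=
  [set i in verts H :\: S | [exists j in S, adj H i j]].

(* The components of [H] are the induced subgraphs on these vertex sets. *)
Definition components H : {set {set vertex G}} :=
  equivalence_partition (connect (adj H)) (verts H).

Definition cc H : nat := #|components H|.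

Definition adjmx H : 'M[R[i]]_#|verts H| :=
  \matrix_(i, j)
    (((vweight (enum_val i))%:C *+ (i == j)) +
     \sum_(e in arcs H | (org e == enum_val i) && (tgt e == enum_val j))
       aweight e).

(* A cycle is presented by a nonempty closed walk without repeated vertices.
   The last condition only matters for length 2, where it forbids going back
   along the same edge; parallel edges and loops do give cycles. *)
Definition is_cycle s : bool :=
  [&& s != [::],
      cycle [rel e f | tgt e == org f] s,
      uniq (map (@org R G) s)
    & all (fun e => ainv e \notin s) s].

Definition cycle_verts s : {set vertex G} := [set org e | e in s].

Definition cycle_arcs s : {set arc G} :=
  [set e | (e \in s) || (ainv e \in s)].

Definition forest H : Prop :=
  forall s, is_cycle s -> ~ {subset s <= arcs H}.

Definition two_regular H : Prop :=
  exists cs : seq (seq (arc G)),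
    [/\ all is_cycle cs,
        pairwise (fun c d => [disjoint cycle_verts c & cycle_verts d]) cs,
        verts H = \bigcup_(c <- cs) cycle_verts c
      & arcs H = \bigcup_(c <- cs) cycle_arcs c].

Definition edges H : {set {set arc G}} :=
  [set [set e; ainv e] | e in arcs H].

(* Degrees count arcs, so a loop contributes 2 to the degree of its vertex. *)
Definition degree_in (M : {set {set arc G}}) (i : vertex G) : nat :=
  #|[set e in cover M | org e == i]|.

Definition saturated (M : {set {set arc G}}) : {set vertex G} :=
  [set org e | e in cover M].

Definition is_matching H (M : {set {set arc G}}) : bool :=
  (M \subset edges H) && [forall i in saturated M, degree_in M i == 1%N].

(* For an edge {e, e^-1} this is -|rho_e|^2, whichever arc is picked. *)
Definition edge_lambda (E : {set arc G}) : R[i] :=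
  if [pick e in E] is Some e then - `|aweight e| ^+ 2 else 0.

Definition matching_poly H : {poly R[i]} :=
  \sum_(M | is_matching H M)
    (\prod_(i in verts H :\: saturated M) ('X - (vweight i)%:C%:P)) *
    (\prod_(E in M) (edge_lambda E)%:P).

Definition aomoto (theta : R) H S : Prop :=
  [/\ S \subset verts H,
      forest (induced H S),
      forall C : {set vertex G}, C \in components (induced H S) ->
        eigenvalue (adjmx (induced (induced H S) C)) theta%:C
    & (#|frontier H S| < cc (induced H S))%N].

End Subgraphs.

Arguments fullg {R} G.

(* Main.v *)
Require Import Defs.
From mathcomp Require Import perm fingroup boolp ring.

(* Let A_w be the adjacency matrix with the arc weights rho replaced by weights
   w of the same moduli, still conjugate on inverse arcs.  The Leibniz expansion
   of det (theta - A_w) is a combination, over the oriented 2-regular subgraphs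
   Gamma, of the numbers mu^(G \ Gamma)(theta); if they all vanish, theta is an
   eigenvalue of A_w for every w.  Choose w generic and let D be the set of
   vertices at which some kernel vector of N = theta - A_w is nonzero; then D is
   an Aomoto subset.  Indeed, rotating the weight of one edge uv inside D must
   not change the kernel dimension, so first-order perturbation theory yields
   conj(x_u) w_uv y_v = conj(x_v) w_vu y_u for all x and y in the space W of
   vectors supported on D and killed by the rows of N in D.  Hence
   - the product of w along a cycle of G[D] would be real, which fails after
     rotating one of its edges: G[D] is a forest;
   - in particular the characteristic polynomial of a component of G[D] does not
     depend on w, and the kernel vectors of N give it the root theta;
   - an element of W is determined by one entry per component, so that
     dim W <= cc(G[D]).
   Finally, rotating an edge between D and its frontier shows that W maps onto
   the functions on the frontier under N; the kernel of this map contains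
   ker N <> 0, so the frontier has fewer than dim W elements. *)

Set Implicit Arguments.
Unset Strict Implicit.
Unset Printing Implicit Defensive.

Import Order.TTheory GRing.Theory Num.Theory.

Local Notation cj := Num.conj.

(** * Kernels of matrices with polynomial entries *)

Section PolynomialPath.

Variable F : numFieldType.

(** A nonzero polynomial certifies that [P] fails at finitely many integers only; products of
    certificates give conjunctions. *)
Definition generically (P : nat -> Prop) : Prop :=
  exists2 p : {poly F}, p != 0 & forall k, p.[k%:R] != 0 -> P k.

Lemma generically_and P Q :
  generically P -> generically Q -> generically (fun k => P k /\ Q k).
Proof.
move=> [p p0 pP] [q q0 qQ]; exists (p * q); first by rewrite mulf_neq0.
by move=> k; rewrite hornerM mulf_eq0 => /norP[/pP Pk /qQ Qk].
Qed.

Lemma generically_imp P Q :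
  generically P -> (forall k, P k -> Q k) -> generically Q.
Proof. by move=> [p p0 pP] PQ; exists p => // k /pP /PQ. Qed.

Lemma generically_forall (T : finType) (P : T -> nat -> Prop) :
  (forall x, generically (P x)) -> generically (fun k => forall x, P x k).
Proof.
move=> gP; suff [p p0 pP] : exists2 p : {poly F}, p != 0 &
    forall k, p.[k%:R] != 0 -> forall x, x \in enum T -> P x k.
  by exists p => // k /pP Pk x; apply: Pk; rewrite mem_enum.
elim: (enum T) => [|x s [p p0 pP]]; first by exists 1; rewrite ?oner_eq0.
have [q q0 qP] := gP x; exists (q * p); first by rewrite mulf_neq0.
move=> k; rewrite hornerM mulf_eq0 => /norP[/qP Pk /pP Psk] y.
by rewrite inE => /predU1P[-> //|/Psk].
Qed.

Lemma poly_eq0_nat (p : {poly F}) : (forall k, p.[k%:R] = 0) -> p = 0.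
Proof.
move=> p0; apply: (@roots_geq_poly_eq0 _ _
  [seq k%:R | k <- iota 0 (size p)]); last by rewrite size_map size_iota.
  by apply/allP => _ /mapP[k _ ->]; apply/rootP.
by rewrite map_inj_uniq ?iota_uniq //; apply: mulrIn; rewrite oner_eq0.
Qed.

Lemma poly_eq0_generic (p : {poly F}) :
  generically (fun k => p.[k%:R] = 0) -> p = 0.
Proof.
move=> [q q0 qp]; suff /eqP : q * p = 0 by rewrite mulf_eq0 (negPf q0) => /eqP.
apply: poly_eq0_nat => k; rewrite hornerM.
by have [->|/qp ->] := eqVneq q.[k%:R] 0; rewrite ?mul0r ?mulr0.
Qed.

Lemma generically_neq0 (p : {poly F}) :
  p != 0 -> generically (fun k => p.[k%:R] != 0).
Proof. by exists p. Qed.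

Lemma generically_pos : generically (fun k => (0 < k)%N).
Proof.
exists 'X; first by rewrite polyX_eq0.
by move=> [|//]; rewrite hornerX eqxx.
Qed.

Lemma generically_ex P : generically P -> exists k, P k.
Proof.
move=> [p p0 pP]; apply/not_existsP => nP; case/negP: p0; apply/eqP.
by apply: poly_eq0_nat => k; apply: contra_notP (nP k) => /eqP; apply: pP.
Qed.

Definition ev_mx m n (Q : 'M[{poly F}]_(m, n)) (k : nat) : 'M[F]_(m, n) :=
  map_mx (horner_eval k%:R) Q.

Lemma ev_mxE m n (Q : 'M[{poly F}]_(m, n)) k i j : ev_mx Q k i j = (Q i j).[k%:R].
Proof. by rewrite mxE. Qed.

Lemma ev_mxM m n p (Q : 'M_(m, n)) (Q' : 'M_(n, p)) k :
  ev_mx (Q *m Q') k = ev_mx Q k *m ev_mx Q' k.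
Proof. exact: map_mxM. Qed.

Lemma ev_mxC m n (A : 'M[F]_(m, n)) k : ev_mx (map_mx polyC A) k = A.
Proof. by apply/matrixP => i j; rewrite !mxE horner_evalE hornerC. Qed.

Lemma ev_mx_generic0 m n (Q : 'M[{poly F}]_(m, n)) :
  generically (fun k => ev_mx Q k = 0) -> Q = 0.
Proof.
move=> [p p0 pQ]; apply/matrixP => i j; rewrite mxE.
apply: poly_eq0_generic; exists p => // k /pQ /matrixP /(_ i j).
by rewrite !mxE.
Qed.

(** Lower semicontinuity of the rank: a minor of [Q] that is nonzero at 0 is a nonzero polynomial.
    Here [\det U] plays the part of the minor: [L] and [K] bring [Q(0)] to its normal form, which
    [copid_mx r] completes to the identity. *)
Lemma mxrank_generic m n (Q : 'M[{poly F}]_(m, n)) :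
  generically (fun k => (\rank (ev_mx Q 0) <= \rank (ev_mx Q k))%N).
Proof.
set A := ev_mx Q 0; set r := \rank A.
pose L := map_mx polyC (pid_mx r *m invmx (col_ebase A) : 'M_(n, m)).
pose K := map_mx polyC (invmx (row_ebase A)).
pose U := L *m Q *m K + map_mx polyC (copid_mx r).
have U0 : ev_mx U 0 = 1%:M.
  rewrite /ev_mx map_mxD -!/(ev_mx _ 0) !ev_mxM !ev_mxC -/A.
  rewrite -[in X in _ *m X *m _](mulmx_ebase A) -/r !mulmxA.
  rewrite mulmxKV ?col_ebase_unit // mulmxK ?row_ebase_unit //.
  by rewrite mul_pid_mx minnn (minn_idPr (rank_leq_row A)) subrKC.
exists (\det U); first apply: contraTneq (oner_neq0 F) => dU.
  by rewrite -(det1 F n) -U0 det_map_mx dU rmorph0 eqxx.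
move=> k; rewrite -[_.[_]]/(horner_eval _ _) -det_map_mx -/(ev_mx U k) => dU.
have: (n <= \rank (ev_mx U k))%N.
  by rewrite mxrank_unit // unitmxE unitfE.
rewrite /ev_mx map_mxD -!/(ev_mx _ k) !ev_mxM !ev_mxC => rU.
have rn : (r <= n)%N by apply: rank_leq_col.
have := leq_trans rU (mxrank_add _ _); rewrite rank_copid_mx // => rU'.
have : (r <= \rank ((pid_mx r : 'M_(n, m)) *m invmx (col_ebase A) *m ev_mx Q k
                    *m invmx (row_ebase A)))%N.
  by rewrite -(leq_add2r (n - r)%N) subnKC.
by move=> /leq_trans -> //; rewrite (leq_trans (mxrankM_maxl _ _)) ?mxrankM_maxr.
Qed.

(* With [r = \rank Q(0)], complete [r] combinations of the rows of [Q] to a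
   matrix [U] that is invertible at 0.  At a generic [k] these combinations span
   the rows of [Q(k)], and Cramer's rule for [U] makes them vanish. *)
Lemma kernel_path n (Q : 'M[{poly F}]_n) (x : 'cV[F]_n) :
    generically (fun k => (\rank (ev_mx Q k) <= \rank (ev_mx Q 0))%N) ->
    ev_mx Q 0 *m x = 0 ->
  exists2 y : 'cV[{poly F}]_n, ev_mx y 0 = x & Q *m y = 0.
Proof.
set A := ev_mx Q 0; set r := \rank A => rQ Ax.
have rn : (r <= n)%N by apply: rank_leq_col.
pose P : 'M_n := pid_mx r *m invmx (col_ebase A).
pose U := map_mx polyC P *m Q + map_mx polyC (copid_mx r *m row_ebase A).
have U0 : ev_mx U 0 = row_ebase A.
  rewrite /ev_mx map_mxD -!/(ev_mx _ 0) ev_mxM !ev_mxC -/A.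
  rewrite -[in X in _ *m X + _](mulmx_ebase A) -/r !mulmxA.
  rewrite mulmxKV ?col_ebase_unit // pid_mx_id // -mulmxDl subrKC.
  by rewrite mul1mx.
pose h := copid_mx r *m row_ebase A *m x.
have Ux : row_ebase A *m x = h.
  rewrite -[LHS]mul1mx -(subrKC (pid_mx r : 'M_n) 1%:M) mulmxDl /h -mulmxA.
  have pA : (pid_mx r : 'M_n) *m (row_ebase A *m x) = 0.
    rewrite -[RHS](mulmx0 _ (invmx (col_ebase A))) -Ax.
    rewrite -[in X in _ = _ *m (X *m _)](mulmx_ebase A) -/r -!mulmxA.
    by rewrite mulKmx ?col_ebase_unit.
  by rewrite pA add0r mulmxA.
(* This constant normalises the polynomial vector [\adj U *m h] so that its value at 0 is [x]. *)
pose c := (\det (row_ebase A))^-1.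
have d0 : \det (row_ebase A) != 0.
  by rewrite -unitfE -unitmxE row_ebase_unit.
exists (map_mx polyC c%:M *m (\adj U *m map_mx polyC h)).
  rewrite !ev_mxM !ev_mxC {1}/ev_mx map_mx_adj -/(ev_mx U 0) U0 -Ux.
  rewrite [X in _ *m X]mulmxA mul_adj_mx !mul_scalar_mx scalerA mulVf //.
  by rewrite scale1r.
apply: ev_mx_generic0.
have dU : \det U != 0.
  apply: contraNneq d0 => dU.
  by rewrite -U0 det_map_mx dU rmorph0.
have := generically_and (generically_neq0 dU) rQ.
move/generically_imp; apply => k [dUk rQk]; rewrite ev_mxM.
set y := ev_mx (map_mx polyC c%:M *m _) k.
have Uk : ev_mx U k = P *m ev_mx Q k + copid_mx r *m row_ebase A.
  by rewrite /ev_mx map_mxD -!/(ev_mx _ k) ev_mxM !ev_mxC.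
have uUk : ev_mx U k \in unitmx by rewrite unitmxE unitfE det_map_mx.
have rP : \rank (P *m ev_mx Q k) = r.
  apply/eqP; rewrite eqn_leq; apply/andP; split.
    rewrite -mulmxA (leq_trans (mxrankM_maxl _ _)) // rank_pid_mx //.
  have := mxrank_add (P *m ev_mx Q k) (copid_mx r *m row_ebase A).
  rewrite -Uk mxrank_unit // => /leq_trans.
  move/(_ _ (leq_add (leqnn _) (mxrankM_maxl _ _))).
  by rewrite rank_copid_mx // -{1}(subnKC rn) leq_add2r.
have sQ : (ev_mx Q k <= P *m ev_mx Q k)%MS.
  by rewrite -(geq_leqif (mxrank_leqif_sup (submxMl _ _))) rP.
have [D ->] := submxP sQ; rewrite -mulmxA.
suff -> : P *m ev_mx Q k *m y = 0 by rewrite mulmx0.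
have Uy : ev_mx U k *m y = (c * (\det U).[k%:R]) *: h.
  rewrite /y !ev_mxM !ev_mxC {2}/ev_mx map_mx_adj -/(ev_mx U k).
  rewrite mul_scalar_mx -scalemxAr mulmxA mul_mx_adj mul_scalar_mx scalerA.
  by rewrite det_map_mx.
have : (pid_mx r : 'M_n) *m (ev_mx U k *m y) = 0.
  by rewrite Uy -scalemxAr /h !mulmxA mul_pid_mx_copid // !mul0mx scaler0.
rewrite Uk mulmxDl mulmxDr !mulmxA mul_pid_mx_copid // !mul0mx addr0.
by rewrite pid_mx_id.
Qed.

End PolynomialPath.

(** * Leibniz formula over a finite type *)

Section Permutations.

Variable T : finType.
Implicit Types s t : {perm T}.

Lemma rank_perm_inj s :
  injective (fun i : 'I_#|T| => enum_rank (s (enum_val i))).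
Proof. by move=> i j /enum_rank_inj /perm_inj /enum_val_inj. Qed.

Definition rank_perm s : 'S_#|T| := perm (@rank_perm_inj s).

Lemma rank_permE s i : rank_perm s i = enum_rank (s (enum_val i)).
Proof. by rewrite permE. Qed.

Lemma rank_permM s t : rank_perm (s * t)%g = (rank_perm s * rank_perm t)%g.
Proof. by apply/permP => i; rewrite permM !rank_permE enum_rankK permM. Qed.

Lemma rank_perm_tperm x y :
  rank_perm (tperm x y) = tperm (enum_rank x) (enum_rank y).
Proof.
apply/permP => i; rewrite rank_permE -{2}(enum_valK i).
by rewrite (inj_tperm _ _ _ enum_rank_inj).
Qed.

Lemma odd_rank_perm s : odd_perm (rank_perm s) = odd_perm s.
Proof.
have [ts -> _] := prod_tpermP s; elim: ts => [|t ts IH].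
  rewrite big_nil [rank_perm _](_ : _ = 1%g) ?odd_perm1 //.
  by apply/permP => i; rewrite rank_permE !perm1 enum_valK.
rewrite big_cons rank_permM !odd_permM IH rank_perm_tperm !odd_tperm.
by rewrite (inj_eq enum_rank_inj).
Qed.

Lemma rank_perm_bij : bijective rank_perm.
Proof.
have inj' (s : 'S_#|T|) : injective (fun x => enum_val (s (enum_rank x))).
  by move=> x y /enum_val_inj /perm_inj /enum_rank_inj.
exists (fun s : 'S_#|T| => perm (@inj' s)) => s; apply/permP => x.
  by rewrite permE rank_permE !enum_rankK.
by rewrite rank_permE permE !enum_valK.
Qed.

Lemma det_finType (C : comNzRingType) (f : T -> T -> C) :
  \det (\matrix_(i < #|T|, j < #|T|) f (enum_val i) (enum_val j)) =
  \sum_(s : {perm T}) (-1) ^+ s * \prod_x f x (s x).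
Proof.
rewrite /determinant (reindex rank_perm) /=; last first.
  exact: onW_bij rank_perm_bij.
apply: eq_bigr => s _; rewrite odd_rank_perm; congr (_ * _).
rewrite (reindex (@enum_rank T)) /=; last first.
  by apply: onW_bij; exists enum_val; [apply: enum_rankK|apply: enum_valK].
by apply: eq_bigr => x _; rewrite mxE rank_permE !enum_rankK.
Qed.

(** An involution is a product of disjoint transpositions, one for each pair of moved points; the
    induction splits off one of them, [tperm x (s x)]. *)
Lemma odd_perm_involution s :
  involutive s -> odd_perm s = odd #|[set x | s x != x]|./2.
Proof.
have [m] := ubnP #|[set x | s x != x]|; elim: m s => // m IH s le_m sK.
have [s1|[x xs]] := set_0Vmem [set x | s x != x].
  rewrite s1 cards0 (_ : s = 1%g) ?odd_perm1 //; apply/permP => x.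
  by rewrite perm1; apply/eqP; move/setP/(_ x): s1; rewrite !inE => /negbFE.
have sx : s x != x by rewrite inE in xs.
pose t := (tperm x (s x) * s)%g.
have tE y : t y = if (y == x) || (y == s x) then y else s y.
  rewrite permM; have [->|yx] := eqVneq y x; first by rewrite tpermL sK.
  have [->|ysx] := eqVneq y (s x); first by rewrite tpermR.
  by rewrite tpermD // eq_sym.
have st : [set y | s y != y] = x |: (s x |: [set y | t y != y]).
  apply/setP => y; rewrite !inE tE.
  have [->|yx] := eqVneq y x; first by rewrite sx.
  have [->|ysx] //= := eqVneq y (s x); by rewrite sK eq_sym sx.
have xt : x \notin s x |: [set y | t y != y].
  by rewrite !inE tE eqxx /= eqxx orbF eq_sym.
have sxt : s x \notin [set y | t y != y].
  by rewrite inE tE eqxx orbT eqxx.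
have cst : #|[set y | s y != y]| = #|[set y | t y != y]|.+2.
  by rewrite st cardsU1 xt cardsU1 sxt.
have tK : involutive t.
  move=> y; rewrite (tE y).
  case: ifP => [yx|/norP[yx ysx]]; first by rewrite tE yx.
  rewrite tE sK -(inj_eq (@perm_inj _ s)) sK (negPf ysx) /=.
  by rewrite (inj_eq (@perm_inj _ s)) (negPf yx).
have os : odd_perm s = ~~ odd_perm t.
  by rewrite /t odd_permM odd_tperm eq_sym sx negbK.
rewrite os (IH t) //; last by rewrite cst ltnS in le_m; apply: leq_ltn_trans le_m.
by rewrite cst.
Qed.

Definition perm_of_fun (f : T -> T) : {perm T} :=
  if injectiveP f is ReflectT f_inj then perm f_inj else 1%g.

Lemma perm_of_funE f : injective f -> perm_of_fun f =1 f.
Proof.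
by move=> f_inj x; rewrite /perm_of_fun; case: injectiveP => // ?; rewrite permE.
Qed.

Lemma big_option (C : nmodType) (P : pred (option T)) (F : option T -> C) :
  \sum_(x | P x) F x = (if P None then F None else 0)
    + \sum_(e | P (Some e)) F (Some e).
Proof.
rewrite (bigID (pred1 None)) /=; congr (_ + _).
  by rewrite big_mkcondl /= big_pred1_eq.
rewrite (reindex_omap Some id) /=; last by case=> [e|] /andP[].
by apply: eq_bigl => e; rewrite andbT eqxx andbT.
Qed.

End Permutations.

(** * Expanding the determinant over oriented 2-regular subgraphs *)

Section Expansion.

Variables (R : realType) (G : wmgraph R) (theta : R).
Notation V := (vertex G).
Notation A := (arc G).
Implicit Types (H : subgraph G) (w : A -> R[i]) (f g : {ffun V -> option A}).

Definition diag_entry H i : R[i] :=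
  if i \in verts H then (theta - vweight i)%:C else 1.

Definition entry H w i j : R[i] :=
  diag_entry H i *+ (i == j)
  - \sum_(e in arcs H | (org e == i) && (tgt e == j)) w e.

(* Up to the identity block outside [H], this is [theta - A] for the arc
   weights [w]. *)
Definition secular_mx H w : 'M[R[i]]_#|V| :=
  \matrix_(i, j) entry H w (enum_val i) (enum_val j).

(** An entry is a diagonal term minus a sum over parallel arcs, so a Leibniz term is refined to a
    choice, in each row, of the diagonal term ([None]) or of one arc ([Some e]). *)
Definition choice_in H f : bool :=
  [forall i, if f i is Some e then (e \in arcs H) && (org e == i) else true].

Lemma choice_inP H f i e :
  choice_in H f -> f i = Some e -> e \in arcs H /\ org e = i.
Proof. by move=> /forallP /(_ i) + fi; rewrite fi => /andP[-> /eqP]. Qed.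

Definition step f i : V := if f i is Some e then tgt e else i.

Definition choice_weight H w i (x : option A) : R[i] :=
  if x is Some e then - w e else diag_entry H i.

(** Distributing the products over the sums in the entries leaves pairs of a permutation and a
    choice; the choice [f] determines the permutation, which is [step f]. *)
Lemma det_secular_mx H w :
  \det (secular_mx H w) =
  \sum_(f : {ffun V -> option A} | choice_in H f && injectiveb (step f))
    (-1) ^+ perm_of_fun (step f) * \prod_i choice_weight H w i (f i).
Proof.
pose ok i j (x : option A) := if x is Some e then
  [&& e \in arcs H, org e == i & tgt e == j] else i == j.
have entryE i j : entry H w i j = \sum_(x | ok i j x) choice_weight H w i x.
  rewrite big_option /= sumrN /entry; congr (_ - _).
  by rewrite mulrb.
rewrite det_finType.
under eq_bigr => s _.
  under eq_bigr => i _ do rewrite entryE.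
  rewrite bigA_distr_big_dep big_distrr /=.
  over.
rewrite (exchange_big_dep (fun f => choice_in H f && injectiveb (step f))) /=.
  apply: eq_bigr => f /andP[fH /injectiveP finj].
  rewrite (big_pred1 (perm_of_fun (step f))) // => s.
  apply/familyP/eqP => [fs|-> i].
    apply/permP => i; rewrite perm_of_funE // /step.
    have := fs i; rewrite unfold_in /ok; case: (f i) => [e|] => [/and3P[_ _]|] /eqP //.
  rewrite unfold_in /ok perm_of_funE // /step.
  case fi: (f i) => [e|] //; have [-> ->] := choice_inP fH fi.
  by rewrite !eqxx.
move=> s f _ /familyP fs.
have sf i : step f i = s i.
  have := fs i; rewrite unfold_in /ok /step.
  by case: (f i) => [e|] => [/and3P[_ _]|] /eqP.
apply/andP; split; last first.
  by apply/injectiveP => i j; rewrite !sf => /perm_inj.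
apply/forallP => i; have := fs i; rewrite unfold_in /ok.
by case: (f i) => [e|] // /and3P[-> ->].
Qed.

(* An oriented 2-regular subgraph of [H] is given by its outgoing arc [g i] at
   each of its vertices [i], with [g i = None] at the other vertices. *)
Definition oriented_2regular H g : bool :=
  [&& choice_in H g, injectiveb (step g)
    & [forall i, if g i is Some e then g (tgt e) != Some (ainv e) else true]].

Definition dom g : {set V} := [set i | g i != None].

Lemma oriented_noback H g i e :
  oriented_2regular H g -> g i = Some e -> g (tgt e) != Some (ainv e).
Proof. by move=> /and3P[_ _ /forallP /(_ i)] + gi; rewrite gi. Qed.

Lemma step_dom g i : injective (step g) -> (step g i \in dom g) = (i \in dom g).
Proof.
move=> g_inj; rewrite !inE; have [gi|gi] := eqVneq (g i) None.
  by rewrite /step !gi.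
apply: contra_neq gi => gsi.
suff <- : step g i = i by [].
by apply: g_inj; rewrite {1}/step gsi.
Qed.

(** Erases from [f] the 2-cycles that run along an edge and back; these become the matching
    [matching_of f]. A loop is never erased, since [f] takes only one of its two arcs at its
    vertex. *)
Definition core f : {ffun V -> option A} :=
  [ffun i => if f i is Some e then
    if f (tgt e) == Some (ainv e) then None else Some e else None].

Definition matched_arcs f : {set A} :=
  [set e | (f (org e) == Some e) && (f (tgt e) == Some (ainv e))].

Definition matching_of f : {set {set A}} :=
  [set [set e; ainv e] | e in matched_arcs f].

Definition arc_from (M : {set {set A}}) i : option A :=
  [pick e in cover M | org e == i].

Definition glue g (M : {set {set A}}) : {ffun V -> option A} :=
  [ffun i => if g i is Some e then Some e else arc_from M i].

Lemma tgt_ainv (e : A) : tgt (ainv e) = org e.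
Proof. by rewrite /tgt ainvK. Qed.

Lemma matched_arcsP f e : reflect (f (org e) = Some e /\ f (tgt e) = Some (ainv e))
  (e \in matched_arcs f).
Proof.
rewrite inE; apply: (iffP andP) => -[].
  by move=> /eqP ? /eqP.
by move=> -> ->.
Qed.

Lemma matched_arcsV f e : (ainv e \in matched_arcs f) = (e \in matched_arcs f).
Proof. by rewrite !inE tgt_ainv ainvK -/(tgt e) andbC. Qed.

Lemma cover_matching_of f : cover (matching_of f) = matched_arcs f.
Proof.
apply/setP => e; rewrite /cover; apply/bigcupP/idP => [[_ /imsetP[e' e'f ->]]|ef].
  by rewrite in_set2 => /orP[]/eqP->; rewrite ?matched_arcsV.
by exists [set e; ainv e]; [apply: imset_f|rewrite !inE eqxx].
Qed.

Section OfChoice.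

Variables (H : subgraph G) (f : {ffun V -> option A}).
Hypotheses (fH : choice_in H f) (finj : injective (step f)).

Lemma step_core_eq i : i \in dom (core f) -> step (core f) i = step f i.
Proof.
rewrite inE /step ffunE; case: (f i) => [e|] //.
by case: ifP; rewrite ?eqxx.
Qed.

Lemma step_core_id i : i \notin dom (core f) -> step (core f) i = i.
Proof. by rewrite inE negbK /step => /eqP->. Qed.

(** Injectivity of [step f] keeps each cycle whole: a vertex fixed by [step f], or lying on an
    erased 2-cycle, already has its only predecessor there, hence is not the successor of a
    remaining vertex. *)
Lemma dom_core_step i : i \in dom (core f) -> step f i \in dom (core f).
Proof.
rewrite inE ffunE; case fi: (f i) => [e|] //.
case: ifP => // /negP fte _; rewrite /step fi inE ffunE.
case fe: (f (tgt e)) => [e'|].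
  case: ifP => // /eqP fe'.
  case: fte; rewrite fe; apply/eqP; congr Some.
  have oe' := (choice_inP fH fe).2.
  have : tgt e' = i.
    by apply: finj; rewrite {1}/step fe' tgt_ainv oe' /step fi.
  by move=> te'; rewrite te' fi in fe'; case: fe' => ->; rewrite ainvK.
have te : tgt e = i by apply: finj; rewrite /step fe fi.
by rewrite te fi in fe.
Qed.

Lemma step_core_inj : injective (step (core f)).
Proof.
move=> i j; have [iC|iC] := boolP (i \in dom (core f));
  have [jC|jC] := boolP (j \in dom (core f)).
- by rewrite !step_core_eq // => /finj.
- rewrite step_core_eq // (step_core_id jC) => ij; case/negP: jC.
  by rewrite -ij dom_core_step.
- rewrite step_core_id // (step_core_eq jC) => ij; case/negP: iC.
  by rewrite ij dom_core_step.
- by rewrite !step_core_id.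
Qed.

Lemma core_someP i e : core f i = Some e ->
  f i = Some e /\ f (tgt e) != Some (ainv e).
Proof.
rewrite ffunE; case: (f i) => [e'|] //.
by case: ifP => // fe [<-]; rewrite fe.
Qed.

Lemma oriented_core : oriented_2regular H (core f).
Proof.
apply/and3P; split.
- apply/forallP => i; case fi: (core f i) => [e|] //.
  by have [/(choice_inP fH)[-> ->] _] := core_someP fi; rewrite eqxx.
- exact/injectiveP/step_core_inj.
apply/forallP => i; case fi: (core f i) => [e|] //.
have [_] := core_someP fi; apply: contra => /eqP fte.
by have [->] := core_someP fte.
Qed.

Lemma matched_arcs_dom e :
  e \in matched_arcs f -> org e \notin dom (core f).
Proof. by rewrite !inE ffunE => /andP[/eqP-> ->]. Qed.

Lemma matching_of_matching :
  is_matching (delete_set H (dom (core f))) (matching_of f).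
Proof.
apply/andP; split.
  apply/subsetP => _ /imsetP[e ef ->]; apply: imset_f.
  have eH : e \in arcs H.
    by have /matched_arcsP[/(choice_inP fH)[]] := ef.
  rewrite inE eH in_setC matched_arcs_dom //= in_setC.
  by apply: matched_arcs_dom; rewrite matched_arcsV.
apply/forall_inP => i; rewrite /degree_in /saturated cover_matching_of.
move=> /imsetP[e ef ->]; apply/cards1P; exists e.
apply/setP => e'; rewrite in_set in_set1; apply/andP/eqP => [[] | ->].
  move=> /matched_arcsP[fe' _] /eqP oe'; have /matched_arcsP[fe _] := ef.
  by move: fe'; rewrite oe' fe => -[].
by rewrite ef eqxx.
Qed.

Lemma glue_matching_of : glue (core f) (matching_of f) = f.
Proof.
apply/ffunP => i; rewrite ffunE.
case ci: (core f i) => [e|]; first by have [->] := core_someP ci.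
rewrite /arc_from cover_matching_of.
case: pickP => [e /andP[+ /eqP <-]|nof]; first by move=> /matched_arcsP[->].
case fi: (f i) => [e|] //.
have := nof e; rewrite inE; have [_ ->] := choice_inP fH fi.
rewrite fi !eqxx /= andbT => fte.
by move: ci; rewrite ffunE fi fte.
Qed.

End OfChoice.

Section OfMatching.

Variables (H : subgraph G) (g : {ffun V -> option A}) (M : {set {set A}}).
Hypotheses (gH : oriented_2regular H g).
Hypothesis (MH : is_matching (delete_set H (dom g)) M).

Let E := cover M.

Lemma matching_edgeP (B : {set A}) : B \in M ->
  exists2 e, e \in arcs (delete_set H (dom g)) & B = [set e; ainv e].
Proof. by have /andP[/subsetP ME _] := MH; move=> /ME /imsetP[e eH ->]; exists e. Qed.

Lemma matching_edge_of e : e \in E -> [set e; ainv e] \in M.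
Proof.
move=> /bigcupP[B BM]; have [e' _ BE] := matching_edgeP BM.
rewrite BE !inE => /orP[]/eqP->; first by rewrite -BE.
by rewrite ainvK setUC -BE.
Qed.

Lemma matchingV e : e \in E -> ainv e \in E.
Proof.
move=> /matching_edge_of eM; apply/bigcupP; exists [set e; ainv e] => //.
by rewrite !inE eqxx orbT.
Qed.

Lemma matching_arcs e : e \in E -> e \in arcs (delete_set H (dom g)).
Proof.
move=> /bigcupP[B BM]; have [e' eH ->] := matching_edgeP BM.
by rewrite !in_set2 => /orP[]/eqP-> //; apply: arcs_inv.
Qed.

Lemma matching_org e : e \in E -> org e \notin dom g.
Proof. by move=> /matching_arcs; rewrite !inE => /and3P[]. Qed.

Lemma matching_org_inj : {in E &, injective (@org R G)}.
Proof.
move=> e e' eE eE' oe; have /andP[_ /forall_inP deg1] := MH.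
have /deg1 : org e \in saturated M by apply: imset_f.
move=> /cards1P[x degx].
have : e \in [set x] by rewrite -degx inE eqxx andbT.
have : e' \in [set x] by rewrite -degx inE oe eqxx andbT.
by rewrite !inE => /eqP-> /eqP->.
Qed.

Lemma arc_fromP e : e \in E -> arc_from M (org e) = Some e.
Proof.
move=> eE; rewrite /arc_from; case: pickP => [e' /andP[e'E /eqP oe]|/(_ e)].
  by congr Some; apply: matching_org_inj.
by rewrite -/E eE eqxx.
Qed.

Lemma arc_fromK i e : arc_from M i = Some e -> e \in E /\ org e = i.
Proof. by rewrite /arc_from; case: pickP => // ? /andP[? /eqP ?] [<-]. Qed.

(** Exchanges the ends of every matching edge: the permutation by which gluing [M] modifies
    [step g]. *)
Definition flip i : V := if arc_from M i is Some e then tgt e else i.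

Lemma flipK : involutive flip.
Proof.
move=> i; rewrite {2}/flip; case ei: (arc_from M i) => [e|]; last by rewrite /flip ei.
have [eE <-] := arc_fromK ei.
by rewrite /flip arc_fromP ?matchingV // tgt_ainv.
Qed.

Lemma glue_dom i : i \in dom g -> glue g M i = g i.
Proof. by rewrite inE ffunE; case: (g i). Qed.

Lemma glue_ndom i : i \notin dom g -> glue g M i = arc_from M i.
Proof. by rewrite inE negbK ffunE => /eqP->. Qed.

Lemma step_glue i : step (glue g M) i = flip (step g i).
Proof.
have /and3P[_ /injectiveP ginj _] := gH.
have [ig|ig] := boolP (i \in dom g).
  rewrite {1}/step glue_dom // -/(step g i) /flip.
  case ei: (arc_from M _) => [e|] //; have [/matching_org] := arc_fromK ei.
  by move=> + oe; rewrite oe step_dom // ig.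
rewrite /step glue_ndom // /flip.
by move: ig; rewrite inE negbK => /eqP->.
Qed.

Lemma step_glue_inj : injective (step (glue g M)).
Proof.
have /and3P[_ /injectiveP ginj _] := gH.
by move=> i j; rewrite !step_glue => /(inv_inj flipK) /ginj.
Qed.

Lemma choice_in_glue : choice_in H (glue g M).
Proof.
have /and3P[gc _ _] := gH.
apply/forallP => i; have [ig|ig] := boolP (i \in dom g).
  by rewrite glue_dom //; have /forallP := gc; apply.
rewrite glue_ndom //; case ei: (arc_from M _) => [e|] //.
have [/matching_arcs + ->] := arc_fromK ei.
by rewrite inE => /andP[->]; rewrite eqxx.
Qed.

Lemma glue_tgt_dom i e : g i = Some e -> glue g M (tgt e) = g (tgt e).
Proof.
move=> gi; have /and3P[_ /injectiveP ginj _] := gH.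
have ->: tgt e = step g i by rewrite /step gi.
by rewrite glue_dom // step_dom // inE gi.
Qed.

Lemma core_glue : core (glue g M) = g.
Proof.
apply/ffunP => i; rewrite ffunE; have [ig|ig] := boolP (i \in dom g).
  rewrite glue_dom //; case gi: (g i) => [e|] //.
  by rewrite (glue_tgt_dom gi) (negPf (oriented_noback gH gi)).
rewrite glue_ndom //; move: ig; rewrite inE negbK => /eqP->.
case ei: (arc_from M _) => [e|] //; have [eE _] := arc_fromK ei.
rewrite glue_ndom; last by rewrite -[tgt e]/(org _) matching_org ?matchingV.
by rewrite arc_fromP ?matchingV // eqxx.
Qed.

Lemma matched_arcs_glue : matched_arcs (glue g M) = E.
Proof.
apply/setP => e; rewrite inE; apply/andP/idP => [[/eqP ge]|eE].
  have [eg|eg] := boolP (org e \in dom g).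
    rewrite glue_dom // in ge.
    by rewrite (glue_tgt_dom ge) (negPf (oriented_noback gH ge)).
  by move: ge; rewrite glue_ndom // => /arc_fromK[].
by rewrite -[tgt e]/(org _) !glue_ndom ?matching_org ?arc_fromP ?matchingV.
Qed.

Lemma matching_of_glue : matching_of (glue g M) = M.
Proof.
apply/setP => B; rewrite /matching_of matched_arcs_glue.
apply/imsetP/idP => [[e /matching_edge_of ? ->] //|BM].
have [e _ BE] := matching_edgeP BM; exists e => //.
by apply/bigcupP; exists B; rewrite // BE !inE eqxx.
Qed.

Lemma trivIset_matching : trivIset M.
Proof.
apply/trivIsetP => B C BM CM; apply: contraR => /pred0Pn[e /andP[eB eC]].
suff blockE X : X \in M -> e \in X -> X = [set e; ainv e].
  by apply/eqP; rewrite (blockE B BM eB) (blockE C CM eC).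
move=> XM; have [e' _ ->] := matching_edgeP XM.
by rewrite in_set2 => /orP[]/eqP-> //; rewrite ainvK setUC.
Qed.

Lemma card_cover_matching : #|E| = #|M|.*2.
Proof.
have /eqP <- := trivIset_matching.
rewrite -mul2n mulnC -sum_nat_const; apply: eq_bigr => B BM.
by have [e _ ->] := matching_edgeP BM; rewrite cards2 eq_sym ainv_neq.
Qed.

(** By [step_glue] the extra factor is the sign of [flip], an involution that moves the [2 * #|M|]
    saturated vertices. *)
Lemma sign_glue :
  (-1) ^+ perm_of_fun (step (glue g M)) =
  (-1) ^+ perm_of_fun (step g) * (-1) ^+ #|M| :> R[i].
Proof.
have /and3P[_ /injectiveP ginj _] := gH.
pose t := perm (inv_inj flipK).
have -> : perm_of_fun (step (glue g M)) = (perm_of_fun (step g) * t)%g.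
  apply/permP => i; rewrite permM permE !perm_of_funE //; first exact: step_glue.
  exact: step_glue_inj.
rewrite odd_permM signr_addb; congr (_ * _).
rewrite odd_perm_involution; last by move=> i; rewrite !permE flipK.
rewrite -[RHS]signr_odd; congr (_ ^+ (odd _)).
suff -> : [set i | t i != i] = saturated M.
  by rewrite card_in_imset ?card_cover_matching ?doubleK //; apply: matching_org_inj.
apply/setP => i; rewrite inE permE /flip; apply/idP/imsetP.
  case ei: (arc_from M i) => [e|]; last by rewrite eqxx.
  by have [eE <-] := arc_fromK ei; exists e.
(* A loop cannot occur in [M]: both its arcs leave the same vertex, against the injectivity of
   origins. *)
move=> [e eE ->]; rewrite arc_fromP //; apply/eqP => te.
have := ainv_neq e; rewrite (matching_org_inj _ eE te) ?eqxx //.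
exact: matchingV.
Qed.

(** Each matched edge contributes the two factors [- w e] and [- w (ainv e)], whose product, the
    squared modulus of the weight, is the opposite of [edge_lambda]. The resulting sign cancels the
    one in [sign_glue]. *)
Lemma weight_glue w :
    (forall e, w e * w (ainv e) = `|aweight e| ^+ 2) ->
  \prod_i choice_weight H w i (glue g M i) =
  \prod_(i in dom g) choice_weight H w i (g i) *
  (\prod_(i in verts (delete_set H (dom g)) :\: saturated M)
      (theta - vweight i)%:C *
   ((-1) ^+ #|M| * \prod_(B in M) edge_lambda B)).
Proof.
move=> wV; rewrite (bigID (mem (dom g))) /=; congr (_ * _).
  by apply: eq_bigr => i ig; rewrite glue_dom.
rewrite (bigID (mem (saturated M))) /= mulrC; congr (_ * _).
  rewrite (bigID (mem (verts H))) /= [X in _ * X]big1 ?mulr1.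
    apply: eq_big => i; first by rewrite !inE -andbA andbCA andbC -!andbA; do !bool_congr.
    case/andP=> /andP[ig iM] iH; rewrite glue_ndom //.
    case ei: (arc_from M i) => [e|]; last by rewrite /= /diag_entry iH.
    by have [eE oe] := arc_fromK ei; case/negP: iM; rewrite -oe imset_f.
  move=> i /andP[/andP[ig iM] iH]; rewrite glue_ndom //.
  case ei: (arc_from M i) => [e|]; last by rewrite /= /diag_entry (negPf iH).
  by have [eE oe] := arc_fromK ei; case/negP: iM; rewrite -oe imset_f.
transitivity (\prod_(e in E) - w e).
  rewrite (eq_big (mem (saturated M))
    (fun i => choice_weight H w i (arc_from M i))); first last.
  - by move=> i /andP[ig _]; rewrite glue_ndom.
  - move=> i; rewrite /= andbC; case: imsetP => //= -[e eE ->].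
    exact: matching_org.
  rewrite (big_imset _ matching_org_inj) /=.
  by apply: eq_bigr => e eE; rewrite arc_fromP.
rewrite big_trivIset ?trivIset_matching // -prodrN; apply: eq_bigr => B BM.
have [e _ BE] := matching_edgeP BM.
have lambdaB : edge_lambda B = - `|aweight e| ^+ 2.
  rewrite /edge_lambda; case: pickP => [e' | /(_ e)]; rewrite BE !inE ?eqxx //.
  by case/orP=> /eqP -> //; rewrite aweightV -[conjc _]/(Num.conj _) norm_conjC.
rewrite lambdaB opprK -wV BE big_setU1 ?big_set1 /= ?mulrNN //.
by rewrite inE eq_sym ainv_neq.
Qed.

End OfMatching.

Definition cycle_coef H w g : R[i] :=
  (-1) ^+ perm_of_fun (step g) * \prod_(i in dom g) choice_weight H w i (g i).

Lemma horner_matching_poly H :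
  (matching_poly H).[theta%:C] =
  \sum_(M | is_matching H M)
    \prod_(i in verts H :\: saturated M) (theta - vweight i)%:C *
    \prod_(B in M) edge_lambda B.
Proof.
rewrite /matching_poly horner_sum; apply: eq_bigr => M _.
rewrite hornerM !horner_prod; congr (_ * _); apply: eq_bigr => i _.
  by rewrite hornerXsubC rmorphB.
by rewrite hornerC.
Qed.

(* Every choice of one Leibniz factor per row splits into an oriented
   2-regular subgraph and a matching of the rest. *)
Lemma det_secular_mx_expand H w :
    (forall e, w e * w (ainv e) = `|aweight e| ^+ 2) ->
  \det (secular_mx H w) =
  \sum_(g | oriented_2regular H g)
    cycle_coef H w g * (matching_poly (delete_set H (dom g))).[theta%:C].
Proof.
move=> wV; rewrite det_secular_mx.
rewrite (partition_big core (oriented_2regular H)) /=; last first.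
  by move=> f /andP[fH /injectiveP finj]; apply: oriented_core.
apply: eq_bigr => g gH; rewrite horner_matching_poly mulr_sumr.
rewrite (reindex_onto (glue g) matching_of) /=; last first.
  by move=> f /andP[/andP[fH finj] /eqP <-]; apply: glue_matching_of fH.
apply: eq_big => [M|M]; last first.
  rewrite -andbA -andbA => /and4P[fH /injectiveP finj /eqP gE /eqP ME].
  have MH : is_matching (delete_set H (dom g)) M.
    by rewrite -ME -{1}gE; apply: matching_of_matching fH.
  rewrite (sign_glue gH MH) (weight_glue MH wV) /cycle_coef.
  rewrite mulrACA -!mulrA; congr (_ * (_ * _)); rewrite mulrCA; congr (_ * _).
  by rewrite mulrA -exprMn mulrNN mulr1 expr1n mul1r.
apply/idP/idP => [|MH].
  rewrite -andbA -andbA => /and4P[fH /injectiveP finj /eqP gE /eqP ME].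
  by rewrite -ME -{1}gE; apply: matching_of_matching fH.
rewrite (choice_in_glue gH MH) (core_glue gH MH) (matching_of_glue gH MH) !eqxx.
by rewrite !andbT; apply/injectiveP/(step_glue_inj gH MH).
Qed.

End Expansion.

(** * The 2-regular subgraph underlying an oriented one *)

Section TwoRegular.

Variables (R : realType) (G : wmgraph R).
Notation V := (vertex G).
Notation A := (arc G).

Variables (H : subgraph G) (g : {ffun V -> option A}).
Hypothesis gH : oriented_2regular H g.

Let ginj : injective (step g).
Proof. by have /and3P[_ /injectiveP]:= gH. Qed.

Let gc : choice_in H g.
Proof. by have /and3P[]:= gH. Qed.

Definition chosen_arcs : {set A} :=
  [set e | (g (org e) == Some e) || (g (tgt e) == Some (ainv e))].

Lemma chosen_arcs_inv e : e \in chosen_arcs -> ainv e \in chosen_arcs.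
Proof. by rewrite !inE tgt_ainv ainvK orbC. Qed.

Lemma chosen_arcs_org e : e \in chosen_arcs -> org e \in dom g.
Proof.
rewrite inE => /orP[] /eqP ge; first by rewrite inE ge.
have -> : org e = step g (tgt e) by rewrite /step ge tgt_ainv.
by rewrite step_dom // inE ge.
Qed.

Definition chosen_subgraph : subgraph G :=
  SubGraph chosen_arcs_inv chosen_arcs_org.

Section Orbit.

Variable e0 : A.

(** The default [e0] only makes the function total; it is not reached as a default on orbits inside
    [dom g]. *)
Let arc_at i : A := odflt e0 (g i).

Let arc_atP i : i \in dom g -> g i = Some (arc_at i).
Proof. by rewrite inE /arc_at; case: (g i). Qed.

Definition orbit_cycle x : seq A := map arc_at (orbit (step g) x).

Lemma orbit_dom x i : x \in dom g -> i \in orbit (step g) x -> i \in dom g.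
Proof.
move=> xg; rewrite -fconnect_orbit => /iter_findex <-.
by elim: (findex _ _ _) => //= n; rewrite step_dom.
Qed.

Lemma org_arc_at i : i \in dom g -> org (arc_at i) = i.
Proof. by move=> /arc_atP/(choice_inP gc)[]. Qed.

Lemma tgt_arc_at i : i \in dom g -> tgt (arc_at i) = step g i.
Proof. by move=> /arc_atP gi; rewrite /step gi. Qed.

Lemma map_org_orbit_cycle x : x \in dom g ->
  map (@org R G) (orbit_cycle x) = orbit (step g) x.
Proof.
move=> xg; rewrite -map_comp -[RHS]map_id; apply/eq_in_map => i ix /=.
by rewrite org_arc_at // (orbit_dom xg).
Qed.

Lemma orbit_cycle_is_cycle x : x \in dom g -> is_cycle (orbit_cycle x).
Proof.
move=> xg; have ox := orbit_dom xg; apply/and4P; split.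
- by rewrite -size_eq0 size_map size_orbit -lt0n fingraph.order_gt0.
- rewrite cycle_map; have := cycle_orbit ginj x.
  have /allP/sub_in_cycle : forall i, i \in orbit (step g) x -> i \in dom g by [].
  apply => i j /= ig jg /eqP ij.
  by rewrite tgt_arc_at // ij org_arc_at.
- by rewrite map_org_orbit_cycle // orbit_uniq.
(* If the arc chosen at [j] were the inverse of the one chosen at [i], then [j] would be the
   terminus of the latter, and [oriented_noback] forbids turning back there. *)
apply/allP => _ /mapP[i /ox ig ->]; apply/mapP => -[j /ox jg ij].
have := oriented_noback gH (arc_atP ig); rewrite ij.
suff -> : tgt (arc_at i) = j by rewrite (arc_atP jg) eqxx.
by rewrite -(org_arc_at jg) -ij.
Qed.

Lemma cycle_verts_orbit x : x \in dom g ->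
  cycle_verts (orbit_cycle x) =i orbit (step g) x.
Proof.
move=> xg i; rewrite -(map_org_orbit_cycle xg).
by apply/imsetP/mapP => -[e ? ->]; exists e.
Qed.

Lemma cycle_arcs_orbit x e : x \in dom g ->
  (e \in cycle_arcs (orbit_cycle x)) =
  (g (org e) == Some e) && (org e \in orbit (step g) x) ||
  (g (tgt e) == Some (ainv e)) && (tgt e \in orbit (step g) x).
Proof.
move=> xg; suff memE f : (f \in orbit_cycle x) =
    (g (org f) == Some f) && (org f \in orbit (step g) x).
  by rewrite inE !memE.
apply/mapP/andP => [[i ix ->]|[/eqP gf fx]].
  have ig := orbit_dom xg ix.
  by rewrite org_arc_at // (arc_atP ig) eqxx.
by exists (org f); rewrite // /arc_at gf.
Qed.

End Orbit.

Lemma two_regular_chosen : two_regular chosen_subgraph.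
Proof.
have [e0 _|noA] := pickP (@predT A); last first.
  exists [::]; split; rewrite // big_nil.
    apply/setP => i; rewrite !inE; case: (g i) => [e|] //.
    by have := noA e.
  by apply/setP => e; have := noA e; rewrite inE.
have csym := fconnect_sym ginj.
(* One representative for each orbit of [step g] inside [dom g]; these orbits are the cycles of the
   decomposition. *)
pose rs := [seq x <- enum (froots (step g)) | x \in dom g].
have rsP x : x \in rs -> x \in dom g /\ froot (step g) x = x.
  by rewrite mem_filter mem_enum => /andP[-> /eqP].
have root_in i : i \in dom g -> exists2 x, x \in rs & i \in orbit (step g) x.
  move=> ig; exists (froot (step g) i).
    rewrite mem_filter mem_enum; apply/andP; split; last exact: roots_root.
    by apply: (orbit_dom ig); rewrite -fconnect_orbit connect_root.
  by rewrite -fconnect_orbit csym connect_root.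
exists (map (orbit_cycle e0) rs); split.
- by apply/allP => _ /mapP[x /rsP[xg _] ->]; apply: orbit_cycle_is_cycle.
- rewrite pairwise_map.
  have : uniq rs by rewrite filter_uniq // enum_uniq.
  rewrite uniq_pairwise; apply: (@sub_in_pairwise _ (mem rs)); last exact/allP.
  move=> x y /rsP[xg rx] /rsP[yg ry] /=; apply: contraR.
  move=> /pred0Pn[i /= /andP[]]; rewrite !cycle_verts_orbit // -!fconnect_orbit.
  move=> xi yi; rewrite -rx -ry (root_connect csym).
  by apply: connect_trans xi _; rewrite csym.
- apply/setP => i; rewrite big_map bigcup_seq; apply/idP/bigcupP => [|[x]].
    move=> /root_in[x xr ix]; exists x; rewrite // cycle_verts_orbit //.
    by have [] := rsP x xr.
  by move=> /rsP[xg _]; rewrite cycle_verts_orbit // => /(orbit_dom xg).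
apply/setP => e; rewrite big_map bigcup_seq; apply/idP/bigcupP => [|[x]].
  rewrite inE => /orP[]/eqP ge.
    have /root_in[x xr ex] : org e \in dom g by rewrite inE ge.
    exists x => //; have [xg _] := rsP x xr.
    by rewrite cycle_arcs_orbit // ge eqxx ex.
  have /root_in[x xr ex] : tgt e \in dom g by rewrite inE ge.
  exists x => //; have [xg _] := rsP x xr.
  by rewrite cycle_arcs_orbit // ge eqxx ex orbT.
move=> /rsP[xg _]; rewrite cycle_arcs_orbit // inE.
by case/orP=> /andP[-> _]; rewrite ?orbT.
Qed.

End TwoRegular.

(** * Singular secular matrices and eigenvalues *)

Section Consequences.

Variables (R : realType) (G : wmgraph R) (theta : R).
Notation V := (vertex G).
Notation A := (arc G).
Implicit Types (H : subgraph G) (w : A -> R[i]) (g : {ffun V -> option A}).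

Lemma det_secular_mx_eq0 H w :
    (forall e, w e * w (ainv e) = `|aweight e| ^+ 2) ->
    (forall K : subgraph G, two_regular K ->
       root (matching_poly (delete_subgraph H K)) theta%:C) ->
  \det (secular_mx theta H w) = 0.
Proof.
move=> wV mu0; rewrite det_secular_mx_expand //; apply: big1 => g gH.
by have /rootP -> := mu0 _ (two_regular_chosen gH); rewrite mulr0.
Qed.

Lemma forest_oriented_dom H g : forest H -> oriented_2regular H g -> dom g = set0.
Proof.
move=> Hfor gH; apply/eqP; apply: contraT => /set0Pn[x xg].
have [e0 _] : exists e, g x = Some e.
  by move: xg; rewrite inE; case: (g x) => [e|] //; exists e.
case: (Hfor _ (orbit_cycle_is_cycle gH e0 xg)) => _ /mapP[i ix ->].
have ig := orbit_dom gH xg ix; have /and3P[gc _ _] := gH.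
move: ig; rewrite inE; case gi: (g i) => [e|] //= _.
by have [] := choice_inP gc gi.
Qed.

(** In a forest an oriented 2-regular subgraph is empty, and [w] enters the expansion only through
    the product over [dom g] in [cycle_coef]. *)
Lemma det_secular_mx_forest H w w' : forest H ->
    (forall e, w e * w (ainv e) = `|aweight e| ^+ 2) ->
    (forall e, w' e * w' (ainv e) = `|aweight e| ^+ 2) ->
  \det (secular_mx theta H w) = \det (secular_mx theta H w').
Proof.
move=> Hfor wV wV'; rewrite !det_secular_mx_expand //; apply: eq_bigr => g gH.
by rewrite /cycle_coef (forest_oriented_dom Hfor gH) !big_set0.
Qed.

Lemma diag_entryT v : diag_entry theta (fullg G) v = (theta - vweight v)%:C.
Proof. by rewrite /diag_entry inE. Qed.

Lemma sum_arcs_from H (v : V) (F : A -> R[i]) :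
  \sum_u \sum_(e in arcs H | (org e == v) && (tgt e == u)) F e =
  \sum_(e in arcs H | org e == v) F e.
Proof.
rewrite (exchange_big_dep (fun e => (e \in arcs H) && (org e == v))) /=; last first.
  by move=> u e _ /and3P[-> ->].
apply: eq_bigr => e /andP[eH ov].
by rewrite (big_pred1 (tgt e)) // => u; rewrite eH ov /= eq_sym.
Qed.

Lemma secular_mulE H w (x : 'cV_#|V|) v :
  (secular_mx theta H w *m x) (enum_rank v) 0 =
  diag_entry theta H v * x (enum_rank v) 0
  - \sum_(e in arcs H | org e == v) w e * x (enum_rank (tgt e)) 0.
Proof.
rewrite mxE (reindex (@enum_rank V)) /=; last first.
  by apply: onW_bij; exists enum_val; [apply: enum_rankK|apply: enum_valK].
under eq_bigr => u _ do rewrite mxE !enum_rankK /entry mulrBl.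
rewrite sumrB (bigD1 v) //= eqxx mulr1n big1 ?addr0; last first.
  by move=> u uv; rewrite eq_sym (negPf uv) mulr0n mul0r.
rewrite -(sum_arcs_from H v); congr (_ - _); apply: eq_bigr => u _.
by rewrite mulr_suml; apply: eq_bigr => e /and3P[_ _ /eqP->].
Qed.

Lemma cV_eqP (x y : 'cV[R[i]]_#|V|) :
  (forall v, x (enum_rank v) 0 = y (enum_rank v) 0) -> x = y.
Proof.
by move=> xy; apply/matrixP => i j; rewrite ord1 -(enum_valK i) xy.
Qed.

Lemma singular_kernel n (M : 'M[R[i]]_n) :
  \det M = 0 -> exists2 x : 'cV_n, x != 0 & M *m x = 0.
Proof.
rewrite -det_tr => /eqP/det0P[v v0 vM]; exists v^T.
  by rewrite -(inj_eq trmx_inj) trmxK trmx0.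
by apply: trmx_inj; rewrite trmx_mul trmxK vM trmx0.
Qed.

Lemma kernel_singular n (M : 'M[R[i]]_n) (x : 'cV_n) :
  x != 0 -> M *m x = 0 -> \det M = 0.
Proof.
move=> x0 Mx; apply/eqP; rewrite -det_tr; apply/det0P; exists x^T.
  by rewrite -(inj_eq trmx_inj) trmxK trmx0.
by rewrite -trmx_mul Mx trmx0.
Qed.

(** The identity block forces a kernel vector [x] to vanish outside [H], so its restriction [z] to
    [verts H] is nonzero and satisfies the eigenvector equation. *)
Lemma eigenvalue_adjmx H :
  \det (secular_mx theta H (@aweight R G)) = 0 -> eigenvalue (adjmx H) theta%:C.
Proof.
move=> /singular_kernel[x x0 Hx].
have xH v : v \notin verts H -> x (enum_rank v) 0 = 0.
  move=> vH; have /matrixP/(_ (enum_rank v) 0) := Hx.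
  rewrite secular_mulE /diag_entry (negPf vH) mxE mul1r big_pred0 ?subr0 //.
  by move=> e; apply/negP => /andP[/arcs_org + /eqP ov]; rewrite ov (negPf vH).
pose z : 'cV_#|verts H| := \col_i x (enum_rank (enum_val i)) 0.
have z0 : z != 0.
  apply: contraNneq x0 => z0; apply/eqP/cV_eqP => v; rewrite mxE.
  have [vH|/xH//] := boolP (v \in verts H).
  have /matrixP/(_ (enum_rank_in vH v) 0) := z0.
  by rewrite !mxE enum_rankK_in.
have Hz : (adjmx H - theta%:C%:M) *m z = 0.
  apply/matrixP => i j; rewrite ord1 {j} mulmxBl mul_scalar_mx.
  rewrite mxE [X in X + _]mxE [X in _ + X]mxE [X in _ - X]mxE [RHS]mxE.
  under eq_bigr => j _ do rewrite [adjmx H i j]mxE mulrDl.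
  rewrite big_split /= (bigD1 i) //= eqxx mulr1n big1 ?addr0; last first.
    by move=> j ji; rewrite eq_sym (negPf ji) mulr0n mul0r.
  have /matrixP/(_ (enum_rank (enum_val i)) 0) := Hx.
  rewrite secular_mulE /diag_entry enum_valP mxE => /eqP; rewrite subr_eq0 => /eqP.
  rewrite -(sum_arcs_from H (enum_val i)).
  rewrite (bigID (mem (verts H))) /= [X in _ = _ + X -> _]big1 ?addr0; last first.
    move=> v vH; rewrite big1 // => e /and3P[_ _ /eqP ->].
    by rewrite xH ?mulr0.
  rewrite big_enum_val => Hi; rewrite [X in _ + X - _](_ : _ =
    (theta - vweight (enum_val i))%:C * z i 0).
    by rewrite rmorphB -mulrDl subrKC subrr.
  rewrite mxE Hi; apply: eq_bigr => j _; rewrite mulr_suml.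
  by apply: eq_bigr => e /and3P[_ _ /eqP->]; rewrite mxE.
(* [eigenvalue] refers to row vectors: without such an eigenvector the matrix would be invertible,
   against the column vector [z]. *)
apply: contraT => no_eig.
have unit_adj : adjmx H - theta%:C%:M \in unitmx.
  by rewrite -row_free_unit -kermx_eq0 -/(eigenspace _ _); apply: contraNT no_eig.
by case/eqP: z0; rewrite -(mulKmx unit_adj z) Hz mulmx0.
Qed.

End Consequences.

(** * Twisting the arc weights by unit complex numbers *)

Section Rotation.

Variable C : numClosedFieldType.
Implicit Type k : nat.

Lemma cayley_den k : (1 + k%:R ^+ 2 : C) != 0.
Proof. by rewrite lt0r_neq0 // ltr_wpDr // exprn_ge0. Qed.

Lemma cayley_mul k : (1 + 'i * k%:R) * (1 - 'i * k%:R) = 1 + k%:R ^+ 2 :> C.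
Proof.
by rewrite mulrC -subr_sqr expr1n exprMn sqrCi mulN1r opprK.
Qed.

Lemma cayley_num_neq0 k : 1 + 'i * k%:R != 0 :> C.
Proof. by apply: contraNneq (cayley_den k) => k0; rewrite -cayley_mul k0 mul0r. Qed.

Lemma cayley_den_neq0 k : 1 - 'i * k%:R != 0 :> C.
Proof. by apply: contraNneq (cayley_den k) => k0; rewrite -cayley_mul k0 mulr0. Qed.

Definition cayley k : C := (1 + 'i * k%:R) / (1 - 'i * k%:R).

Lemma conj_cayley k : cj (cayley k) = (1 - 'i * k%:R) / (1 + 'i * k%:R).
Proof.
by rewrite rmorphM fmorphV rmorphD rmorphB rmorph1 rmorphM /= conjCi conjC_nat mulNr opprK.
Qed.

Lemma norm_cayley k : `|cayley k| = 1.
Proof.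
apply/eqP; rewrite -(@pexpr_eq1 _ _ 2) // normCK conj_cayley mulrA mulfVK //.
  by rewrite divff // cayley_num_neq0.
exact: cayley_den_neq0.
Qed.

(** Together with its conjugate version, this makes the increment of a twist polynomial in [k], with
    a factor [k] that [current] divides out. *)
Lemma cayley_sub1 k :
  (1 + k%:R ^+ 2) * (cayley k - 1) = k%:R * (2 * 'i * (1 + 'i * k%:R)).
Proof.
rewrite mulrBr mulr1 -cayley_mul /cayley mulrACA divff ?cayley_den_neq0 //.
ring.
Qed.

Lemma conj_cayley_sub1 k :
  (1 + k%:R ^+ 2) * (cj (cayley k) - 1) = - (k%:R * (2 * 'i * (1 - 'i * k%:R))).
Proof.
rewrite mulrBr mulr1 -cayley_mul conj_cayley [X in X * _]mulrC mulrACA.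
rewrite divff ?cayley_num_neq0 //.
ring.
Qed.

(** Subtracting the two preceding identities gives [(1 + k^2) * (cayley k - cj (cayley k)) = 4 * 'i
    * k]. *)
Lemma cayley_nonreal k : (0 < k)%N -> cj (cayley k) != cayley k.
Proof.
move=> k0; apply/eqP => cc.
have := cayley_sub1 k; have := conj_cayley_sub1 k; rewrite cc => -> /eqP.
rewrite eq_sym -addr_eq0 [X in X == _](_ : _ = k%:R * (4 * 'i)); last by ring.
by rewrite !mulf_eq0 !pnatr_eq0 (negPf (neq0Ci _)) !orbF eqn0Ngt k0.
Qed.

Lemma cayley_neq1 k : (0 < k)%N -> cayley k != 1.
Proof. by move=> k0; apply: contraNneq (cayley_nonreal k0) => ->; rewrite rmorph1. Qed.

End Rotation.

(** * Weights of prescribed moduli, twists of one edge and maximal ranks *)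

Section Phases.

Variables (R : realType) (G : wmgraph R) (theta : R).
Notation V := (vertex G).
Notation A := (arc G).
Notation F := (R[i]).
Notation rk := (@enum_rank V).
Implicit Types (w : A -> F) (S : {set V}) (e : A).

(** The weights allowed for [A_w]: the secular matrix of [G] stays Hermitian, and the products
    [w e * w (ainv e)] in the determinant expansion keep their values. *)
Definition phase w : Prop :=
  (forall e, w (ainv e) = cj (w e)) /\ (forall e, `|w e| = `|aweight e|).

Lemma phase_aweight : phase (@aweight R G).
Proof. by split=> // e; rewrite aweightV. Qed.

Lemma phase_mulV w e : phase w -> w e * w (ainv e) = `|aweight e| ^+ 2.
Proof. by move=> [wV wn]; rewrite wV -normCK wn. Qed.

Lemma phase_neq0 w e : phase w -> w e != 0.
Proof. by move=> [_ wn]; rewrite -normr_eq0 wn normr_eq0 aweight_neq0. Qed.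

Definition twist e0 (u : F) w e : F :=
  if e == e0 then u * w e else if e == ainv e0 then cj u * w e else w e.

Lemma ainv_eq e e' : (ainv e == e') = (e == ainv e').
Proof. by rewrite -(inj_eq (inv_inj (@ainvK R G))) ainvK. Qed.

Lemma phase_twist e0 u w : `|u| = 1 -> phase w -> phase (twist e0 u w).
Proof.
move=> u1 [wV wn]; split=> e; rewrite /twist.
  rewrite ainv_eq (inj_eq (inv_inj (@ainvK R G))).
  have [->|ne] := eqVneq e (ainv e0).
    by rewrite (negPf (ainv_neq e0)) ainvK rmorphM /= conjCK -wV ainvK.
  by have [->|ne'] := eqVneq e e0; rewrite ?rmorphM /= ?wV.
case: ifP => _; first by rewrite normrM u1 mul1r.
by case: ifP => _ //; rewrite normrM norm_conjC u1 mul1r.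
Qed.

Notation N := (secular_mx theta (fullg G)).

Lemma sum_single (P : pred A) (c : F) e0 :
  \sum_(e | P e) c *+ (e == e0) = c *+ (P e0).
Proof.
rewrite big_mkcond (bigD1 e0) //= eqxx mulr1n big1 ?addr0; first by case: (P e0).
by move=> e /negPf ->; rewrite mulr0n if_same.
Qed.

Lemma mulmx_sub_sandwich (K : comPzRingType) m n p q (f : 'M[K]_(m, n))
    (X Y : 'M_(n, p)) (z : 'M_(p, q)) (a b : K) :
  f *m ((a *: X - b *: Y) *m z) = a *: (f *m (X *m z)) - b *: (f *m (Y *m z)).
Proof. by rewrite mulmxBl mulmxBr -!scalemxAl -!scalemxAr. Qed.

Lemma mx_subsubE (K : pzRingType) m n (X Y Z : 'M[K]_(m, n)) (a b : K) i j :
  (X - a *: Y - b *: Z) i j = X i j - a * Y i j - b * Z i j.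
Proof. by rewrite !mxE. Qed.

Lemma secular_twist e0 u w :
  N (twist e0 u w) = N w
    - ((u - 1) * w e0) *: delta_mx (rk (org e0)) (rk (tgt e0))
    - ((cj u - 1) * w (ainv e0)) *: delta_mx (rk (tgt e0)) (rk (org e0)).
Proof.
have twistE e : twist e0 u w e = w e + ((u - 1) * w e0) *+ (e == e0)
    + ((cj u - 1) * w (ainv e0)) *+ (e == ainv e0).
  rewrite /twist; have [->|ne] := eqVneq e e0.
    by rewrite eq_sym (negPf (ainv_neq _)) mulr0n mulr1n; ring.
  by have [->|ne'] := eqVneq e (ainv e0); rewrite ?mulr0n ?mulr1n; ring.
have rkE v (i : 'I_#|V|) : (i == rk v) = (v == enum_val i).
  by rewrite -(inj_eq enum_val_inj) enum_rankK eq_sym.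
apply/matrixP => i j; rewrite mx_subsubE ![N _ i j]mxE ![delta_mx _ _ i j]mxE !rkE /entry.
under eq_bigr => e _ do rewrite twistE.
rewrite !big_split /= !sum_single !inE /= -/(tgt e0) tgt_ainv !mulr_natr.
by rewrite !opprD !addrA.
Qed.

(** Its value at 0 is the opposite of the derivative of [twist_path] at 0. *)
Definition twist_increment e0 w : 'M[{poly F}]_#|V| :=
  ((2 * 'i * w e0)%:P * (1 + 'i%:P * 'X))
     *: map_mx polyC (delta_mx (rk (org e0)) (rk (tgt e0)))
  - ((2 * 'i * w (ainv e0))%:P * (1 - 'i%:P * 'X))
     *: map_mx polyC (delta_mx (rk (tgt e0)) (rk (org e0))).

(* [cayley k] parametrises the unit circle rationally, and the factor
   [1 + k ^ 2] clears the denominator. *)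
Definition twist_path e0 w : 'M[{poly F}]_#|V| :=
  (1 + 'X ^+ 2) *: map_mx polyC (N w) - 'X *: twist_increment e0 w.

Lemma twist_path_entry e0 w i j :
  twist_path e0 w i j = (1 + 'X ^+ 2) * (N w i j)%:P
    - 'X * ((2 * 'i * w e0)%:P * (1 + 'i%:P * 'X)
              * (delta_mx (rk (org e0)) (rk (tgt e0)) i j)%:P
          - (2 * 'i * w (ainv e0))%:P * (1 - 'i%:P * 'X)
              * (delta_mx (rk (tgt e0)) (rk (org e0)) i j)%:P).
Proof.
rewrite /twist_path /twist_increment; move: (N w) (delta_mx _ _) (delta_mx _ _) => X Y Z.
by rewrite !mxE.
Qed.

Lemma ev_twist_path e0 w k :
  ev_mx (twist_path e0 w) k = (1 + k%:R ^+ 2) *: N (twist e0 (cayley _ k) w).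
Proof.
rewrite secular_twist; apply/matrixP => i j.
rewrite ev_mxE [RHS]mxE mx_subsubE twist_path_entry !hornerE.
set a := N w i j; set b := delta_mx _ _ i j; set c := delta_mx _ _ i j.
rewrite !mulrBr ![in RHS]mulrA cayley_sub1 conj_cayley_sub1.
ring.
Qed.

Lemma ev_twist_path0 e0 w : ev_mx (twist_path e0 w) 0 = N w.
Proof. by apply/matrixP => i j; rewrite ev_mxE twist_path_entry !hornerE; ring. Qed.

Definition proj S : 'M[F]_#|V| := diag_mx (\row_i (enum_val i \in S)%:R).

Lemma projE S m (X : 'M_(_, m)) v j :
  (proj S *m X) (rk v) j = if v \in S then X (rk v) j else 0.
Proof.
by rewrite mul_diag_mx !mxE enum_rankK; case: ifP; rewrite ?mul1r ?mul0r.
Qed.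

Lemma projT : proj [set: V] = 1%:M.
Proof. by apply/matrixP => i j; rewrite !mxE inE. Qed.

Definition block S w : 'M[F]_#|V| := proj S *m N w *m proj S.

Definition block_path S e0 w : 'M[{poly F}]_#|V| :=
  map_mx polyC (proj S) *m twist_path e0 w *m map_mx polyC (proj S).

Lemma ev_block_path S e0 w k : ev_mx (block_path S e0 w) k =
  (1 + k%:R ^+ 2) *: block S (twist e0 (cayley _ k) w).
Proof. by rewrite !ev_mxM !ev_mxC ev_twist_path -scalemxAr -scalemxAl. Qed.

Lemma ev_block_path0 S e0 w : ev_mx (block_path S e0 w) 0 = block S w.
Proof. by rewrite !ev_mxM !ev_mxC ev_twist_path0. Qed.

Definition unit_row v : 'rV[F]_#|V| := delta_mx 0 (rk v).

(** Compared with the rank of [N w], its rank tells whether every kernel vector vanishes at [v];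
    keeping these ranks therefore keeps the support of the kernel. *)
Definition bordered v w : 'M[F]_(#|V| + 1, #|V|) :=
  col_mx (N w) (unit_row v).

Definition rank_sum w : nat :=
  (\sum_(S : {set V}) \rank (block S w) + \sum_v \rank (bordered v w))%N.

(* A substitute for a generic choice of [w]: generic twists of one edge can only
   raise these ranks, so at a maximum of their sum they keep each of them. *)
Definition max_phase w : Prop :=
  phase w /\ forall w', phase w' -> (rank_sum w' <= rank_sum w)%N.

Lemma max_phase_exists : exists w, max_phase w.
Proof.
pose P m := `[< exists2 w, phase w & rank_sum w = m >].
have exP : exists m, P m.
  exists (rank_sum (@aweight R G)); apply/asboolP.
  by exists (@aweight R G); first exact: phase_aweight.
have ubP m : P m -> (m <= \sum_(S : {set V}) #|V| + \sum_(v : V) #|V|)%N.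
  by case/asboolP=> w _ <-; apply: leq_add; apply: leq_sum => ? _; apply: rank_leq_col.
have [m /asboolP[w phw rw] max_m] := ex_maxnP exP ubP.
exists w; split=> // w' phw'; rewrite rw; apply: max_m; apply/asboolP.
by exists w'.
Qed.

Definition same_ranks w w' : Prop :=
  (forall S, \rank (block S w') = \rank (block S w)) /\
  (forall v, \rank (bordered v w') = \rank (bordered v w)).

Lemma same_ranks_max w w' :
  max_phase w -> phase w' -> same_ranks w w' -> max_phase w'.
Proof.
move=> [_ max_w] phw' [rS rv]; split=> // w2 /max_w /leq_trans -> //.
by rewrite /rank_sum (eq_bigr _ (fun S _ => rS S)) (eq_bigr _ (fun v _ => rv v)).
Qed.

Lemma max_phase_twist w e0 : max_phase w ->
  generically F (fun k => same_ranks w (twist e0 (cayley _ k) w)).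
Proof.
move=> [phw max_w].
have nz k := cayley_den F k.
have gS : generically F (fun k => forall S,
    (\rank (block S w) <= \rank (block S (twist e0 (cayley _ k) w)))%N).
  apply: generically_forall => S.
  apply: generically_imp (mxrank_generic (block_path S e0 w)) _ => k.
  by rewrite ev_block_path0 ev_block_path mxrank_scale_nz.
have gv : generically F (fun k => forall v,
    (\rank (bordered v w) <= \rank (bordered v (twist e0 (cayley _ k) w)))%N).
  apply: generically_forall => v.
  (* The unit row is multiplied by [1 + 'X ^+ 2] too, so that the value at [k] is a nonzero multiple
     of the whole bordered matrix. *)
  apply: generically_imp (mxrank_generic (col_mx (twist_path e0 w)
    ((1 + 'X ^+ 2) *: map_mx polyC (unit_row v)))) _ => k.
  rewrite /ev_mx !map_col_mx -!/(ev_mx _ _) ev_twist_path0 ev_twist_path.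
  have evd l : ev_mx ((1 + 'X ^+ 2) *: map_mx polyC (unit_row v)) l
     = (1 + l%:R ^+ 2) *: unit_row v.
    by apply/matrixP => i j; rewrite ev_mxE !mxE !hornerE.
  by rewrite !evd expr0n addr0 scale1r -scale_col_mx mxrank_scale_nz.
apply: generically_imp (generically_and gS gv) _ => k [leS lev].
have : (rank_sum (twist e0 (cayley _ k) w) <= rank_sum w)%N.
  by apply: max_w; apply: phase_twist; rewrite ?norm_cayley.
have leSum : forall (I : finType) (E1 E2 : I -> nat), (forall i, (E1 i <= E2 i)%N) ->
  (\sum_i E2 i <= \sum_i E1 i)%N -> forall i, E2 i = E1 i.
  move=> I E1 E2 le12 le21 i.
  have /leqif_sum := fun i (_ : predT i) => leqif_eq (le12 i).
  by move=> /geq_leqif; rewrite le21 => /esym/forallP /(_ i) /eqP.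
rewrite /rank_sum => le_sum; split; apply: leSum => //.
  rewrite -(leq_add2r (\sum_v \rank (bordered v w))); apply: leq_trans le_sum.
  by rewrite leq_add2l leq_sum.
rewrite -(leq_add2l (\sum_(S : {set V}) \rank (block S w))).
by apply: leq_trans le_sum; rewrite leq_add2r leq_sum.
Qed.

End Phases.

(** * Kernel vectors at a phase of maximal rank *)

Lemma mul_delta_sandwich (K : comPzRingType) n (u : 'rV[K]_n) i j (y : 'cV[K]_n) :
  (u *m delta_mx i j *m y) 0 0 = u 0 i * y j 0.
Proof.
by rewrite -(mul_delta_mx (0 : 'I_1)) -!mulmxA -rowE mulmxA -colE mxE big_ord1 !mxE.
Qed.

Lemma mul_delta_sub_sandwich (K : comPzRingType) n (u : 'rV[K]_n) (a b : K)
    i j k l (y : 'cV[K]_n) :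
  (u *m (a *: delta_mx i j - b *: delta_mx k l) *m y) 0 0 =
  a * (u 0 i * y j 0) - b * (u 0 k * y l 0).
Proof.
rewrite mulmxBr mulmxBl -!scalemxAr -!scalemxAl mxE -!mul_delta_sandwich.
rewrite [(- _ : 'M_(_, _)) 0 0]mxE [(a *: _ : 'M_(_, _)) 0 0]mxE.
by rewrite [(b *: _ : 'M_(_, _)) 0 0]mxE.
Qed.

Section Support.

Variables (R : realType) (G : wmgraph R) (theta : R).
Notation V := (vertex G).
Notation A := (arc G).
Notation F := (R[i]).
Notation rk := (@enum_rank V).
Notation N := (secular_mx theta (fullg G)).
Implicit Types (w : A -> F) (S : {set V}) (e : A) (x y : 'cV[F]_#|V|).

Definition ksupp w : {set V} := [set v | ~~ (unit_row v <= N w)%MS].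

Lemma ksuppP w v :
  reflect (exists2 x : 'cV[F]_#|V|, N w *m x = 0 & x (rk v) 0 != 0) (v \in ksupp w).
Proof.
rewrite inE submxE; apply: (iffP idP) => [|[x Nx xv]].
  move=> /matrix0Pn[i [j]]; rewrite ord1 -rowE mxE => cv.
  exists (col j (cokermx (N w))); last by rewrite mxE.
  by rewrite colE mulmxA mulmx_coker mul0mx.
rewrite -submxE; apply: contra xv => /submxP[D dE].
have : unit_row v *m x = 0 by rewrite dE -mulmxA Nx mulmx0.
by rewrite -rowE => /matrixP /(_ 0 0); rewrite !mxE => ->.
Qed.

Lemma ksupp0 w x v : N w *m x = 0 -> v \notin ksupp w -> x (rk v) 0 = 0.
Proof. by move=> Nx; apply: contraNeq => xv; apply/ksuppP; exists x. Qed.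

Lemma same_ranks_ksupp w w' : same_ranks theta w w' -> ksupp w' = ksupp w.
Proof.
move=> [rS rv]; have rN : \rank (N w') = \rank (N w).
  by have := rS [set: V]; rewrite /block projT !mul1mx !mulmx1.
have subE z v : (unit_row v <= N z)%MS = (\rank (bordered theta v z) == \rank (N z)).
  rewrite /bordered -addsmxE -[RHS]eq_sym.
  rewrite (mxrank_leqif_sup (addsmxSl _ _)).2 addsmx_sub submx_refl.
  by [].
by apply/setP => v; rewrite !inE !subE rv rN.
Qed.

(** For [S = ksupp w] this is the space [W]. The rows outside [S] impose nothing, so it may be
    larger than the kernel of [N w]. *)
Definition block_kernel S w x : Prop :=
  (forall v, v \notin S -> x (rk v) 0 = 0) /\
  (forall v, v \in S -> (N w *m x) (rk v) 0 = 0).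

Lemma proj_support S x : (forall v, v \notin S -> x (rk v) 0 = 0) -> proj S *m x = x.
Proof.
by move=> xS; apply: cV_eqP => v; rewrite projE; case: ifPn => // /xS.
Qed.

Lemma kernel_block w x : N w *m x = 0 -> block_kernel (ksupp w) w x.
Proof.
by move=> Nx; split=> v vD; rewrite ?Nx ?mxE //; apply: ksupp0 vD.
Qed.

Lemma block_kernelE S w x : block_kernel S w x -> block theta S w *m x = 0.
Proof.
move=> [xS Nx]; apply: cV_eqP => v; rewrite -!mulmxA (proj_support xS) projE [RHS]mxE.
by case: ifP => // vS; apply: Nx.
Qed.

Definition adjoint x : 'rV[F]_#|V| := (map_mx cj x)^T.

Lemma conj_entry w u v :
  phase w -> cj (entry theta (fullg G) w u v) = entry theta (fullg G) w v u.
Proof.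
move=> [wV _]; rewrite /entry rmorphB rmorphMn rmorph_sum /=.
congr (_ - _).
  rewrite eq_sym; have [->|] := eqVneq v u; last by rewrite !mulr0n.
  by rewrite !mulr1n diag_entryT -[LHS]/(conjc _) conjc_real.
rewrite (reindex_inj (inv_inj (@ainvK R G))) /=.
apply: eq_big => [e|e _]; first by rewrite !inE tgt_ainv -/(tgt e) /= andbC.
by rewrite wV conjCK.
Qed.

Lemma adjoint_mul w x : phase w -> adjoint x *m N w = adjoint (N w *m x).
Proof.
move=> phw; rewrite /adjoint map_mxM trmx_mul; congr (_ *m _).
by apply/matrixP => i j; rewrite !mxE /= conj_entry.
Qed.

Lemma adjoint_proj S x : adjoint (proj S *m x) = adjoint x *m proj S.
Proof.
rewrite /adjoint map_mxM trmx_mul; congr (_ *m _).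
apply/matrixP => i j; rewrite !mxE rmorphMn /= rmorph_nat eq_sym.
by have [->|] := eqVneq i j; rewrite ?mulr0n.
Qed.

(* First-order perturbation theory: since twisting [e] does not raise the rank
   of the block, the derivative of the twist pairs kernel vectors to 0. *)
Lemma current w S x y e : max_phase theta w ->
    block_kernel S w x -> block_kernel S w y ->
  org e \in S -> tgt e \in S ->
  cj (x (rk (org e)) 0) * w e * y (rk (tgt e)) 0 =
  cj (x (rk (tgt e)) 0) * w (ainv e) * y (rk (org e)) 0.
Proof.
move=> maxw kx ky oS tS; have [phw _] := maxw.
pose P := map_mx polyC (proj S : 'M[F]_#|V|).
pose Q := block_path theta S e w.
have Q0 : ev_mx Q 0 = block theta S w by rewrite ev_block_path0.
have [|z z0 Qz] := @kernel_path F _ Q y _ (etrans (congr1 (mulmx^~ y) Q0) (block_kernelE ky)).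
  apply: generically_imp (max_phase_twist e maxw) _ => k [rS _].
  by rewrite Q0 ev_block_path mxrank_scale_nz ?cayley_den // rS.
pose f := map_mx polyC (adjoint x).
have fP : f *m P = f.
  by rewrite -map_mxM -adjoint_proj (proj_support kx.1).
have fNP : f *m map_mx polyC (N w) *m P = 0.
  rewrite -!map_mxM adjoint_mul // -adjoint_proj; apply/eqP.
  rewrite map_mx_eq0; apply/eqP; rewrite [proj S *m _](_ : _ = 0).
    by rewrite /adjoint map_mx0 trmx0.
  by apply: cV_eqP => v; rewrite projE [RHS]mxE; case: ifP => //; apply: kx.2.
(* Since [f] kills [N w] on the block, only the increment survives in [f *m (Q *m z) = 0]; its
   factor ['X] is cancelled, and evaluation at 0 then gives the claim. *)
have fpz : f *m twist_increment e w *m (P *m z) = 0.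
  have : f *m (Q *m z) = 0 by rewrite Qz mulmx0.
  have -> : Q *m z = P *m (twist_path theta e w *m (P *m z)) by rewrite !mulmxA.
  rewrite mulmxA fP mulmx_sub_sandwich.
  rewrite [f *m (_ *m (P *m z))](_ : _ = 0); last by rewrite !mulmxA fNP mul0mx.
  rewrite scaler0 sub0r => /eqP; rewrite oppr_eq0 scalemx_eq0 polyX_eq0 /=.
  by rewrite mulmxA => /eqP.
have := congr1 (fun M => ev_mx M 0) fpz.
rewrite !ev_mxM !ev_mxC z0 (proj_support ky.1).
have -> : ev_mx (twist_increment e w) 0 =
    (2 * 'i * w e) *: delta_mx (rk (org e)) (rk (tgt e))
    - (2 * 'i * w (ainv e)) *: delta_mx (rk (tgt e)) (rk (org e)).
  by apply/matrixP => i j; rewrite ev_mxE !mxE !hornerE; ring.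
move=> /matrixP /(_ 0 0); rewrite mul_delta_sub_sandwich !mxE horner_evalE horner0.
move=> /eqP; rewrite subr_eq0 => /eqP E.
have i2 : (2 * 'i : F) != 0 by rewrite mulf_neq0 ?pnatr_eq0 ?neq0Ci.
apply: (mulfI i2); move: E => /=.
set a := cj _; set b := cj _; set c := y _ _; set d := y _ _ => E.
rewrite [RHS](_ : _ = 2 * 'i * w (ainv e) * (b * d)); last by ring.
by rewrite -E; ring.
Qed.

End Support.

(** * The kernel support is a forest with eigenvalue [theta] on each component *)

Section MaximalPhase.

Variables (R : realType) (G : wmgraph R) (theta : R).
Notation V := (vertex G).
Notation A := (arc G).
Notation F := (R[i]).
Notation rk := (@enum_rank V).
Notation N := (secular_mx theta (fullg G)).
Notation ksupp := (ksupp theta).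
Notation block_kernel := (block_kernel theta).
Implicit Types (w : A -> F) (S : {set V}) (e : A) (x y : 'cV[F]_#|V|).

Lemma arcs_induced (H : subgraph G) S e :
  (e \in arcs (induced H S)) = [&& e \in arcs H, org e \in S & tgt e \in S].
Proof. by rewrite in_set. Qed.

Lemma induced_full_arcs S e :
  (e \in arcs (induced (fullg G) S)) = (org e \in S) && (tgt e \in S).
Proof. by rewrite arcs_induced in_setT. Qed.

Lemma adj_arc (H : subgraph G) e : e \in arcs H -> adj H (org e) (tgt e).
Proof. by move=> eH; apply/existsP; exists e; rewrite eH !eqxx. Qed.

Lemma adjP (H : subgraph G) u v :
  reflect (exists e, [/\ e \in arcs H, org e = u & tgt e = v]) (adj H u v).
Proof.
apply: (iffP existsP) => -[e]; last by case=> eH <- <-; exists e; rewrite eH !eqxx.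
by move=> /and3P[eH /eqP <- /eqP <-]; exists e.
Qed.

(** Apply [current] to [y] and a kernel vector [x] nonzero at [org e]: when [y] vanishes at [org e],
    the product that must be 0 has no other possibly zero factor than [y] at [tgt e]. *)
Lemma kernel_step w y e : max_phase theta w -> block_kernel (ksupp w) w y ->
    e \in arcs (induced (fullg G) (ksupp w)) ->
  y (rk (org e)) 0 = 0 -> y (rk (tgt e)) 0 = 0.
Proof.
move=> maxw ky; rewrite induced_full_arcs => /andP[oD tD] y0.
have /ksuppP[x Nx xo] := oD.
have := current maxw (kernel_block Nx) ky oD tD.
rewrite y0 mulr0 => /eqP; rewrite !mulf_eq0 conjC_eq0 (negPf xo) /=.
by rewrite (negPf (phase_neq0 e maxw.1)) => /eqP.
Qed.

Lemma kernel_connect w y u v : max_phase theta w ->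
    block_kernel (ksupp w) w y ->
    connect (adj (induced (fullg G) (ksupp w))) u v ->
  y (rk u) 0 = 0 -> y (rk v) 0 = 0.
Proof.
move=> maxw ky /connectP[p + ->]; elim: p u => //= a p IH u /andP[/adjP[e [eD <- <-]]].
by move=> /IH {}IH /(kernel_step maxw ky eD) /IH.
Qed.

Lemma cycle_tgt_prod (f : V -> F) (s : seq A) :
  path.cycle [rel e e' | tgt e == org e'] s ->
  \prod_(e <- s) f (tgt e) = \prod_(e <- s) f (org e).
Proof.
case: s => [|e p] /=; first by rewrite !big_nil.
have pathE a q : path [rel e e' | tgt e == org e'] a q ->
    map (@tgt R G) (belast a q) = map (@org R G) q.
  by elim: q a => //= b q IH a /andP[/eqP -> /IH ->].
move=> pe; have := pathE _ _ pe; rewrite belast_rcons map_rcons => E.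
rewrite -(big_map (@tgt R G) xpredT f) E -(big_map (@org R G) xpredT f) /=.
by rewrite big_rcons big_cons /= mulrC.
Qed.

(** Multiply the identities of [current] for [y = x] around the cycle: both sides carry the factor
    [cj X * X], where [X] is the product of the entries of [x] along the cycle. *)
Lemma cycle_weight_real w s : max_phase theta w ->
    is_cycle s -> {subset s <= arcs (induced (fullg G) (ksupp w))} ->
  cj (\prod_(e <- s) w e) = \prod_(e <- s) w e.
Proof.
move=> maxw /and4P[s0 cyc _ _] sD; have [phw _] := maxw.
have [e0 e0s] : exists e0, e0 \in s.
  by case: (s) s0 => // e0 s' _; exists e0; rewrite inE eqxx.
have : org e0 \in ksupp w by have := sD _ e0s; rewrite induced_full_arcs => /andP[].
move=> /ksuppP[x Nx xe0]; have kx := kernel_block Nx.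
(* Nonvanishing spreads from [org e0]: by [kernel_step] on the inverse arc, a zero at the next
   vertex would propagate back. *)
have xs e : e \in s -> x (rk (org e)) 0 != 0.
  have [i s' sE] := rot_to e0s.
  have : path [rel e e' | tgt e == org e'] e0 s'.
    by move: cyc; rewrite -(rot_cycle i) sE /= rcons_path => /andP[].
  rewrite -(mem_rot i s e) sE.
  have : {subset e0 :: s' <= arcs (induced (fullg G) (ksupp w))}.
    by move=> a; rewrite -sE mem_rot => /sD.
  elim: s' e0 xe0 {e0s sE} => [|b s' IH] a xa aD.
    by rewrite inE => _ /eqP ->.
  move=> /= /andP[/eqP ab pb]; rewrite inE => /predU1P[-> //|]; apply: IH => //.
    rewrite -ab; apply: contra xa => /eqP xt; apply/eqP.
    have := @kernel_step _ _ (ainv a) maxw kx.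
    rewrite tgt_ainv -/(tgt a); apply=> //; apply: arcs_inv; apply: aD.
    by rewrite inE eqxx.
  by move=> c cs; apply: aD; rewrite inE cs orbT.
pose X := \prod_(e <- s) x (rk (org e)) 0.
have X0 : X != 0 by rewrite prodf_seq_neq0; apply/allP => e /xs.
have XE : \prod_(e <- s) x (rk (tgt e)) 0 = X.
  exact: (cycle_tgt_prod (fun v => x (rk v) 0) cyc).
have : \prod_(e <- s) (cj (x (rk (org e)) 0) * w e * x (rk (tgt e)) 0) =
       \prod_(e <- s) (cj (x (rk (tgt e)) 0) * cj (w e) * x (rk (org e)) 0).
  rewrite big_seq [RHS]big_seq; apply: eq_bigr => e /sD; rewrite induced_full_arcs.
  by move=> /andP[oD tD]; rewrite (current maxw kx kx oD tD) phw.1.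
rewrite !big_split /= -!rmorph_prod /= XE -/X => E.
apply: (mulfI (x := cj X * X)); first by rewrite mulf_neq0 ?conjC_eq0.
by rewrite mulrAC -E mulrAC.
Qed.

(** A cycle takes [e0] once and never [ainv e0], so only one factor changes. *)
Lemma twist_cycle_prod w s e0 u : is_cycle s -> e0 \in s ->
  \prod_(e <- s) twist e0 u w e = u * \prod_(e <- s) w e.
Proof.
move=> /and4P[_ _ /map_uniq us /allP back] e0s.
rewrite !(bigD1_seq e0) //= mulrA; congr (_ * _); first by rewrite /twist eqxx.
rewrite big_seq_cond [RHS]big_seq_cond; apply: eq_bigr => e /andP[es ne].
rewrite /twist (negPf ne); case: eqP => // ee.
by have := back _ e0s; rewrite -ee es.
Qed.

(** A generic twist of one arc of a cycle is again a maximal phase with the same support. The weight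
    of the cycle would be real before and after, although it is multiplied by a nonreal number. *)
Lemma ksupp_forest w : max_phase theta w -> forest (induced (fullg G) (ksupp w)).
Proof.
move=> maxw s cyc sD; have [phw _] := maxw.
have [e0 e0s] : exists e0, e0 \in s.
  by case/and4P: cyc; case: (s) => // e0 s' _; exists e0; rewrite inE eqxx.
have [k [sr k0]] :=
  generically_ex (generically_and (max_phase_twist e0 maxw) (generically_pos F)).
have phw' := phase_twist e0 (norm_cayley F k) phw.
have maxw' := same_ranks_max maxw phw' sr.
have := @cycle_weight_real _ s maxw' cyc.
rewrite (same_ranks_ksupp sr) twist_cycle_prod // => /(_ sD).
rewrite rmorphM /= (cycle_weight_real maxw cyc sD) => /mulIf E.
have /eqP := cayley_nonreal F k0; apply; apply: E.
by rewrite prodf_seq_neq0; apply/allP => e _; apply: phase_neq0.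
Qed.

Lemma component_eigenvalue w C : max_phase theta w ->
    C \in components (induced (fullg G) (ksupp w)) ->
  eigenvalue (adjmx (induced (induced (fullg G) (ksupp w)) C)) theta%:C.
Proof.
move=> maxw; set D := ksupp w; set HD := induced _ D; set HC := induced HD C.
have [phw _] := maxw.
move=> /imsetP[c cD CE].
have CP v : (v \in C) = (v \in D) && connect (adj HD) c v.
  by rewrite CE !inE.
have cC : c \in C by rewrite CP connect0 andbT; move: cD; rewrite !inE.
have /ksuppP[x Nx xc] : c \in ksupp w by move: cD; rewrite !inE.
have HCfor : forest HC.
  move=> s cyc sC; apply: (ksupp_forest maxw cyc) => e /sC.
  by rewrite arcs_induced => /andP[].
apply: eigenvalue_adjmx.
(* The component is a forest, so its determinant can be computed with [w] in place of the original
   weights. *)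
rewrite (det_secular_mx_forest theta HCfor (w' := w)); first last.
- by move=> e; apply: phase_mulV.
- by move=> e; apply/phase_mulV/phase_aweight.
apply: (@kernel_singular _ _ _ (proj C *m x)).
  apply: contraNneq xc => y0; have := projE C x c 0.
  by rewrite y0 cC mxE => <-.
apply: cV_eqP => v; rewrite secular_mulE projE [RHS]mxE.
have vHC : (v \in verts HC) = (v \in C).
  by rewrite /= !in_setI in_setT andb_idl // CP => /andP[].
rewrite /diag_entry vHC; case: ifPn => vC; last first.
  rewrite mulr0 big_pred0 ?subr0 // => e; apply/negP => /andP[/arcs_org + /eqP oe].
  by rewrite oe vHC (negPf vC).
transitivity ((N w *m x) (rk v) 0); last by rewrite Nx mxE.
rewrite secular_mulE diag_entryT; congr (_ - _).
rewrite [RHS](bigID (mem (arcs HC))) /= [X in _ = _ + X]big1 ?addr0.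
  apply: eq_big => [e|e /andP[eHC _]].
    by rewrite in_setT andbC.
  rewrite projE; by move: eHC; rewrite arcs_induced => /and3P[_ _ ->].
(* An arc leaving the component ends outside [D], where [x] vanishes; hence restricting [x] to [C]
   keeps the equation at [v]. *)
move=> e /andP[/andP[_ /eqP oe] eHC].
rewrite (ksupp0 Nx) ?mulr0 //; apply: contra eHC => tD.
have oD : org e \in D by move: vC; rewrite oe CP => /andP[].
have eHD : e \in arcs HD by rewrite induced_full_arcs oD.
rewrite arcs_induced eHD oe vC CP tD /=.
apply: connect_trans (connect1 (adj_arc eHD)).
by move: vC; rewrite oe CP => /andP[].
Qed.

End MaximalPhase.

(** * Counting frontier vertices and components *)

Lemma mul_delta_col (K : pzRingType) m n i j (y : 'cV[K]_n) k :
  ((delta_mx i j : 'M_(m, n)) *m y) k 0 = y j 0 *+ (k == i).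
Proof.
rewrite mxE (bigD1 j) //= mxE eqxx andbT big1 ?addr0 ?mulr_natl //.
by move=> l lj; rewrite mxE (negPf lj) andbF mul0r.
Qed.

Lemma mul_sub_delta_col (K : pzRingType) m n (X : 'M[K]_(m, n)) a b i j k l
    (y : 'cV_n) v :
  ((X - a *: delta_mx i j - b *: delta_mx k l) *m y) v 0 =
  (X *m y) v 0 - a * (y j 0 *+ (v == i)) - b * (y l 0 *+ (v == k)).
Proof. by rewrite !mulmxBl -!scalemxAl mx_subsubE !mul_delta_col. Qed.

Section Counting.

Variables (R : realType) (G : wmgraph R) (theta : R).
Notation V := (vertex G).
Notation A := (arc G).
Notation F := (R[i]).
Notation rk := (@enum_rank V).
Notation N := (secular_mx theta (fullg G)).
Implicit Types (x y : 'cV[F]_#|V|).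

Variable w : A -> F.
Hypothesis maxw : max_phase theta w.

Notation D := (ksupp theta w).
Notation HD := (induced (fullg G) D).
Notation T := (frontier (fullg G) D).
Notation W := (block_kernel theta D w).

Let phw : phase w := maxw.1.

(** Its row space is [W], transposed. The summand [proj (~: D)] imposes vanishing off [D]; the two
    summands have nonzero rows at disjoint sets of vertices, so they vanish separately on a kernel
    vector. *)
Definition kernel_mx : 'M[F]_#|V| :=
  kermx (proj D *m N w *m proj D + proj (~: D))^T.

Lemma kernel_mxP x : (x^T <= kernel_mx)%MS <-> W x.
Proof.
split=> [/sub_kermxP|[xD Nx]].
  rewrite -trmx_mul => /(congr1 trmx); rewrite trmxK trmx0 => Zx.
  have Zv v : ((proj D *m N w *m proj D) *m x) (rk v) 0 + (proj (~: D) *m x) (rk v) 0 = 0.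
    by rewrite mulmxDl in Zx; have /matrixP/(_ (rk v) 0) := Zx; rewrite mxE [RHS]mxE.
  have xD v : v \notin D -> x (rk v) 0 = 0.
    move=> vD; have := Zv v.
    by rewrite -!mulmxA !projE (negPf vD) in_setC vD add0r.
  split=> // v vD; have := Zv v.
  by rewrite -!mulmxA (proj_support xD) !projE vD in_setC vD addr0.
apply/sub_kermxP; rewrite -trmx_mul -[RHS]trmx0; congr trmx; apply: cV_eqP => v.
rewrite mulmxDl mxE -!mulmxA (proj_support xD) !projE in_setC [RHS]mxE.
by have [vD|vD] := boolP (v \in D); rewrite /= ?Nx ?xD ?addr0 //.
Qed.

Lemma adj_connect_sym : connect_sym (adj HD).
Proof.
apply: sym_connect_sym => u v; apply/adjP/adjP => -[e [eD <- <-]];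
  by exists (ainv e); rewrite tgt_ainv; split=> //; apply: arcs_inv.
Qed.

(** By [kernel_connect] an element of [W] that vanishes at one vertex of each component is 0. The
    matrix [rep] reads these entries; its default 0 does not occur, as components are nonempty. *)
Lemma rank_kernel_mx : (\rank kernel_mx <= cc HD)%N.
Proof.
pose rep : 'M[F]_(#|V|, cc HD) := \matrix_(i, j)
  if [pick v in (enum_val j : {set V})] is Some v then (i == rk v)%:R else 0.
suff <- : \rank (kernel_mx *m rep) = \rank kernel_mx by apply: rank_leq_col.
apply/mxrank_injP/rowV0P => r; rewrite sub_capmx => /andP[].
rewrite -[r]trmxK; move: r^T => x /kernel_mxP kx /sub_kermxP xrep.
rewrite (_ : x = 0) ?trmx0 //; apply: cV_eqP => v; rewrite [RHS]mxE.
have [vD|/kx.1//] := boolP (v \in D).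
pose B := [set u in verts HD | connect (adj HD) v u].
have vH : v \in verts HD by rewrite /= in_setI in_setT.
have BC : B \in components HD by apply/imsetP; exists v.
have := congr1 (fun M : 'rV_(cc HD) => M 0 (enum_rank_in BC B)) xrep.
rewrite !mxE; under eq_bigr => i _ do rewrite [rep _ _]mxE enum_rankK_in //.
case: pickP => [u|/(_ v)]; last by rewrite in_set connect0 vH.
rewrite in_set => /andP[_ vu]; rewrite (bigD1 (rk u)) //= eqxx mulr1 mxE big1 ?addr0.
  by apply: kernel_connect maxw kx _; rewrite adj_connect_sym.
by move=> i /negPf ->; rewrite mulr0.
Qed.

Definition frontier_mx : 'M[F]_(#|V|, #|T|) :=
  \matrix_(i, j) N w (rk (enum_val j)) i.

Lemma frontier_mxE x j : (x^T *m frontier_mx) 0 j = (N w *m x) (rk (enum_val j)) 0.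
Proof. by rewrite !mxE; apply: eq_bigr => i _; rewrite !mxE mulrC. Qed.

Lemma frontier_edge v : v \in T ->
  exists e, [/\ org e = v, tgt e \in D & v \notin D].
Proof.
rewrite inE => /andP[+ /existsP[u /andP[uD /adjP[e [_ oe te]]]]].
by rewrite in_setD => /andP[vD _]; exists e; rewrite te.
Qed.

(* Twisting an arc from the frontier to [D] moves a kernel vector inside [W],
   so a linear form on the frontier vanishing on the image of [W] is 0. *)
Lemma kernel_frontier_full : \rank (kernel_mx *m frontier_mx) = #|T|.
Proof.
apply/eqP; rewrite -mxrank_tr; apply/eqP/eqP; rewrite -/(row_free _) -kermx_eq0.
apply/rowV0P => l /sub_kermxP; rewrite -[l]trmxK -trmx_mul => /(congr1 trmx).
rewrite trmxK trmx0 trmxK => Wl.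
have {}Wl y : W y -> y^T *m frontier_mx *m l^T = 0.
  by move=> /kernel_mxP/submxP[E ->]; rewrite -(mulmxA E kernel_mx) -(mulmxA E) Wl mulmx0.
apply/rowP => j; rewrite mxE; apply/eqP; apply: contraT => lj.
have [e0 [oe tD vD]] := frontier_edge (enum_valP j).
have /ksuppP[x Nx xt] := tD.
pose Q := block_path theta [set: V] e0 w.
have blockT w' : block theta [set: V] w' = N w'.
  by rewrite /block projT mul1mx mulmx1.
have Q0x : ev_mx Q 0 *m x = 0 by rewrite ev_block_path0 blockT.
have [|z z0 Qz] := kernel_path _ Q0x.
  apply: generically_imp (max_phase_twist e0 maxw) _ => k [rS _].
  by rewrite ev_block_path0 ev_block_path mxrank_scale_nz ?cayley_den // rS.
pose p := z (rk (tgt e0)) 0.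
have p0 : p != 0.
  apply: contraNneq xt => p0; rewrite -z0 ev_mxE -/p p0 horner0 //.
(* A generic [k] keeps the ranks, keeps [y] nonzero at [tgt e0], and is positive, so that the twist
   is not trivial. *)
have [k [[sr pk] k0]] := generically_ex (generically_and
  (generically_and (max_phase_twist e0 maxw) (generically_neq0 p0))
  (generically_pos F)).
pose w' := twist e0 (cayley F k) w.
pose y := ev_mx z k.
have Ny : N w' *m y = 0.
  have := congr1 (fun M => ev_mx M k) Qz.
  rewrite ev_mxM ev_block_path blockT -scalemxAl => /eqP.
  rewrite [X in _ == X](_ : _ = 0); last first.
    by apply/matrixP => ? ?; rewrite !mxE horner_evalE horner0.
  by rewrite scalemx_eq0 (negPf (cayley_den F k)) => /eqP.
have yD v : v \notin D -> y (rk v) 0 = 0.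
  by rewrite -(same_ranks_ksupp sr); apply: ksupp0.
pose c := (cayley F k - 1) * w e0 * y (rk (tgt e0)) 0.
(* [N w] and [N w'] differ in the twisted entries only. One of these meets [y] at [org e0], which is
   outside [D], so that [N w *m y] is concentrated at the frontier vertex [org e0]. *)
have NwE v : (N w *m y) (rk v) 0 = c *+ (v == enum_val j).
  have := congr1 (fun M : 'cV_#|V| => M (rk v) 0) Ny.
  rewrite /w' secular_twist mul_sub_delta_col oe [X in _ - X](_ : _ = 0); last first.
    by rewrite -oe yD ?oe // mul0rn mulr0.
  rewrite subr0 [RHS]mxE => /eqP; rewrite subr_eq0 => /eqP ->.
  by rewrite (inj_eq enum_rank_inj) mulrnAr.
have Wy : W y.
  by split=> // v vD'; rewrite NwE; case: eqP => // ve; rewrite -ve vD' in vD.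
have := congr1 (fun M : 'M_1 => M 0 0) (Wl y Wy).
rewrite mxE (bigD1 j) //= frontier_mxE NwE eqxx mulr1n big1 ?addr0; last first.
  by move=> i ij; rewrite frontier_mxE NwE (inj_eq enum_val_inj) (negPf ij) mul0r.
rewrite !mxE => /eqP; rewrite !mulf_eq0 subr_eq0 (negPf (cayley_neq1 F k0)).
rewrite (negPf (phase_neq0 e0 phw)) (negPf lj) orbF /= => /eqP yt.
by case/eqP: pk; rewrite /p -ev_mxE.
Qed.

Lemma frontier_lt_cc : \det (N w) = 0 -> (#|T| < cc HD)%N.
Proof.
move=> /singular_kernel[x x0 Nx]; apply: leq_trans rank_kernel_mx.
rewrite -kernel_frontier_full ltn_neqAle mxrankM_maxl andbT.
apply: contra x0 => /eqP/mxrank_injP/rowV0P/(_ x^T); rewrite -trmx_eq0 => -> //.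
rewrite sub_capmx; apply/andP; split.
  exact/kernel_mxP/kernel_block.
by apply/sub_kermxP/rowP => j; rewrite frontier_mxE Nx !mxE.
Qed.

End Counting.

Theorem theorem8 (R : realType) (G : wmgraph R) (theta : R)
    (noAomoto : ~ (exists S : {set vertex G}, aomoto theta (fullg G) S)) :
  exists Gamma : subgraph G,
    two_regular Gamma /\
    ~~ root (matching_poly (delete_subgraph (fullg G) Gamma)) theta%:C.
Proof.
(* By contraposition: if all these matching polynomials vanish at [theta], the kernel support at a
   maximal phase is an Aomoto subset. *)
apply: contrapT => noGamma; apply: noAomoto.
have [w maxw] := max_phase_exists G theta.
exists (ksupp theta w); split.
- by rewrite subsetT.
- exact: ksupp_forest.
- by move=> C; apply: component_eigenvalue.
apply: frontier_lt_cc => //; apply: det_secular_mx_eq0 => [e|K K2].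
  by apply: phase_mulV; apply: maxw.1.
by apply: contrapT => /negP Kroot; apply: noGamma; exists K.
Qed.
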